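(* Let $\{k_n\}_{n\in\mathbb N}$ be an increasing sequence of positive integers with $k_n\le n$, $\lim_{n\to\infty}k_n=\infty$ and $\lim_{n\to\infty}k_n/n=0$. Fix a constant $D\in(0,\infty)$, a deterministic sequence $\{d_n\}_{n\in\mathbb N}$ of positive integers with $\limsup_{n\to\infty}n^{-1}\log(d_n)=0$, and i.i.d. random variables $\{X_j\}_{j=1}^\infty$ satisfying Assumptions 2, 3 and 4 listed in the context. For every $n\in\mathbb N$, let $\mathcal W_n=\{v^{(n,1)},\dots,v^{(n,d_n)}\}\subset\mathbb R^{k_n}$ be a finite collection of (deterministic) vectors such that $\|v^{(n,j)}\|_2=D$ for all $n\in\mathbb N$ and $j\in\{1,\dots,d_n\}$. Fix $c\in(-\infty,T)$, where $T$ is the constant from Assumption 3. Then for $\sigma$-a.e. $a=\{a^{(n)}\}_{n\in\mathbb N}\in\mathbb V$, $$\lim_{n\to\infty}\sup_{1\le j\le d_n}\left|F_n(v^{(n,j)},a^{(n)},c)-\mathbb E\left[\overline\Lambda(Dg,c)\right]\right|=0,$$ where $g$ is a standard Gaussian random variable.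
   Context: Notation: $\mathbb R_+=[0,\infty)$. ''Increasing'' means $k_{n+1}\ge k_n$ for all $n$. For $k\le n$, $\mathbb V_{n,k}=\{A\in\mathbb R^{n\times k}:A^{\mathsf T}A=I_k\}$; $\sigma_n$ is the Haar (invariant) probability measure on $\mathbb V_{n,k_n}$; $\mathbb V=\prod_n\mathbb V_{n,k_n}$; $\sigma$ is any probability measure on $\mathbb V$ whose $n$-th marginal is $\sigma_n$ for every $n$. Let $\eta:\mathbb R\to\mathbb R_+$ be a fixed non-constant continuous function and let $\overline\Lambda(t_1,t_2)=\log\mathbb E[\exp(t_1X_1+t_2\eta(X_1))]\in\mathbb R\cup\{\infty\}$. Assumption 2: $X_1$ has mean zero and there is $C_2>0$ with $\mathbb P(|X_1|\ge s)\le2\exp(-s^2/C_2^2)$ for all $s\ge0$. Assumption 3: there is $0<T\le\infty$ such that $\overline\Lambda$ is finite on $\mathbb R\times(-\infty,T)$; $\overline\Lambda$ is essentially smooth; and the derivatives $\partial_1^\alpha\partial_2^\beta\overline\Lambda$ exist on $\mathbb R\times(-\infty,T)$ for all integers $\alpha,\beta\ge0$ with $\alpha+\beta\le2$. Assumption 4: there is a continuous $\tilde C:(-\infty,T)\to\mathbb R_+$ with $|\partial_1^\alpha\partial_2^\beta\overline\Lambda(t_1,t_2)|\le\tilde C(t_2)(1+|t_1|^{2-\alpha})$ for all $(t_1,t_2)\in\mathbb R\times(-\infty,T)$ and all integers $\alpha,\beta\ge0$ with $\alpha+\beta\le2$. A convex $f:\mathbb R^d\to(-\infty,\infty]$ with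 $\mathcal D_f=\{f<\infty\}$ is essentially smooth if $\mathcal D_f^\circ\neq\emptyset$, $f$ is differentiable on $\mathcal D_f^\circ$, and $|\nabla f(\lambda_n)|\to\infty$ whenever $\lambda_n\in\mathcal D_f^\circ$ converges to a boundary point of $\mathcal D_f^\circ$. For $u\in\mathbb R^{k_n}$, $a^{(n)}\in\mathbb V_{n,k_n}$ with $i$-th row $a_i^{(n)}$, and $c\in\mathbb R$, $$F_n(u,a^{(n)},c)=\frac1n\sum_{i=1}^n\overline\Lambda\left(\langle u,\sqrt n\,a_i^{(n)}\rangle,c\right).$$ *)

(* Defs.v *)
From HB Require Import structures.
From mathcomp Require Import all_boot all_order all_algebra finmap.
From mathcomp Require Import all_classical all_reals all_analysis.

Set Implicit Arguments.
Unset Strict Implicit.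
Unset Printing Implicit Defensive.

Import Order.TTheory GRing.Theory Num.Theory.
Import numFieldNormedType.Exports.

Local Open Scope classical_set_scope.
Local Open Scope ring_scope.

Section euclidean.
Variables (R : realType) (d : nat).
Implicit Types (u v : 'rV[R]_d).

Definition inner u v : R := \sum_(i < d) u 0 i * v 0 i.

(* The library norm on matrices is the sup norm, not the Euclidean one. *)
Definition norm2 u : R := Num.sqrt (inner u u).

Definition gradient (f : 'rV[R]_d -> R) u : 'rV[R]_d :=
  \row_(i < d) 'D_(delta_mx 0 i) f u.

Definition proper_domain (f : 'rV[R]_d -> \bar R) : set 'rV[R]_d :=
  [set x | (f x < +oo)%E].

Definition econvex (f : 'rV[R]_d -> \bar R) : Prop :=
  (forall x, f x != -oo%E) /\
  (forall (x y : 'rV[R]_d) (t : R), 0 <= t <= 1 ->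
    (f (t *: x + (1 - t) *: y)%R <= t%:E * f x + (1 - t)%:E * f y)%E).

Definition essentially_smooth (f : 'rV[R]_d -> \bar R) : Prop :=
  let U := interior (proper_domain f) in
  let g := fun x => fine (f x) in
  [/\ econvex f,
      U !=set0,
      forall x, U x -> differentiable g x &
      forall (l : nat -> 'rV[R]_d) (x : 'rV[R]_d),
        (forall n, U (l n)) -> l @ \oo --> x -> (closure U `\` U) x ->
        norm2 (gradient g (l n)) @[n --> \oo] --> +oo].

End euclidean.

Section stiefel.
Variable R : realType.

(* V_{n,k} is parametrized by a proof of k <= n so that it is inhabited, as
   the library requires of a measurable space. *)
Record stiefel (n k : nat) (lekn : (k <= n)%N) := Stiefel {
  stiefel_mx :> 'M[R]_(n, k) ;
  stiefelP : stiefel_mx^T *m stiefel_mx == 1%:M }.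

Section type.
Variables (n k : nat) (lekn : (k <= n)%N).
Local Notation V := (stiefel lekn).

HB.instance Definition _ := [isSub for @stiefel_mx n k lekn].
HB.instance Definition _ := [Choice of V by <:].

Lemma stiefel_point_subproof :
  (pid_mx k : 'M[R]_(n, k))^T *m (pid_mx k : 'M[R]_(n, k)) == 1%:M.
Proof.
by rewrite tr_pid_mx mul_pid_mx minnn (minn_idPr lekn) pid_mx_1.
Qed.

HB.instance Definition _ := isPointed.Build V
  (Stiefel lekn stiefel_point_subproof).

(* Open sets of the subspace topology inherited from R^(n x k). *)
Definition stiefel_open : set (set V) :=
  [set (@stiefel_mx n k lekn) @^-1` U | U in open].

Definition stiefel_borel := g_sigma_algebraType stiefel_open.

End type.

Lemma stiefel_act_subproof n k (lekn : (k <= n)%N)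
    (Q : stiefel (leqnn n)) (A : stiefel lekn) :
  (stiefel_mx Q *m stiefel_mx A)^T *m (stiefel_mx Q *m stiefel_mx A) == 1%:M.
Proof.
rewrite trmx_mul mulmxA -(mulmxA _ _ (stiefel_mx Q)).
by rewrite (eqP (stiefelP Q)) mulmx1 (eqP (stiefelP A)).
Qed.

(* The left action of the orthogonal group O(n) = V_{n,n} on V_{n,k}; it is
   transitive, so the invariant probability measure is unique. *)
Definition stiefel_act n k (lekn : (k <= n)%N)
    (Q : stiefel (leqnn n)) (A : stiefel lekn) : stiefel lekn :=
  Stiefel lekn (stiefel_act_subproof Q A).

Definition stiefel_haar n k (lekn : (k <= n)%N)
    (mu : probability (stiefel_borel lekn) R) : Prop :=
  forall (Q : stiefel (leqnn n)) (B : set (stiefel_borel lekn)),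
    measurable B -> mu (stiefel_act Q @^-1` B) = mu B.

(* The factor n = 0 is harmless: lekn 0 forces k 0 = 0, and V_{0,0} is a
   single point. *)
Section product.
Variables (k : nat -> nat) (lekn : forall n, (k n <= n)%N).

Definition stiefel_seq := forall n, stiefel_borel (lekn n).

Definition stiefel_cylinder : set (set stiefel_seq) :=
  [set C | exists (n : nat) (B : set (stiefel_borel (lekn n))),
    measurable B /\ C = [set a | B (a n)]].

Definition stiefel_prod := g_sigma_algebraType stiefel_cylinder.

End product.
End stiefel.

Section random_variables.
Local Open Scope ereal_scope.
Variables (R : realType) (d : measure_display) (Om : measurableType d).
Variable P : probability Om R.

Definition mutually_independent (X : nat -> {RV P >-> R}) : Prop :=
  forall (J : {fset nat}) (B : nat -> set R),
    (forall j, measurable (B j)) ->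
    P (\bigcap_(j in [set` J]) (X j @^-1` B j)) =
    \prod_(j <- J) P (X j @^-1` B j).

Definition identically_distributed (X : nat -> {RV P >-> R}) : Prop :=
  forall (i j : nat) (B : set R), measurable B ->
    distribution P (X i) B = distribution P (X j) B.

Definition iid (X : nat -> {RV P >-> R}) : Prop :=
  mutually_independent X /\ identically_distributed X.

Definition standard_gaussian (g : {RV P >-> R}) : Prop :=
  forall B : set R, measurable B -> distribution P g B = normal_prob 0%R 1%R B.

Definition centered_subgaussian (X : {RV P >-> R}) : Prop :=
  'E_P[X] = 0 /\
  exists2 C2 : R, (0 < C2)%R & forall s : R, (0 <= s)%R ->
    P [set w | (s <= `|X w|)%R] <= (2 * expR (- (s ^+ 2 / C2 ^+ 2)))%:E.

Definition log_laplace (eta : R -> R) (X : {RV P >-> R}) (t1 t2 : R) : \bar R :=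
  lne 'E_P[fun w => expR (t1 * X w + t2 * eta (X w))].

End random_variables.

Section partial_derivatives.
Variable R : realType.
Implicit Types (f : R -> R -> R) (a b : nat).

(* partial a b f is d_1^a d_2^b f: first b derivatives in t2, then a in t1. *)
Definition partial a b f : R -> R -> R :=
  fun t1 t2 => derive1n a (fun s => derive1n b (f s) t2) t1.

(* The last differentiation in the definition of partial a b f is legitimate
   at (t1, t2); the earlier ones are those of lower order. *)
Definition partial_exists a b f (t1 t2 : R) : Prop :=
  match a, b with
  | a'.+1, _ => derivable (fun s => partial a' b f s t2) t1 1
  | 0%N, b'.+1 => derivable (fun r => partial 0 b' f t1 r) t2 1
  | 0%N, 0%N => True
  end.

End partial_derivatives.

Section assumptions.
Variables (R : realType) (L : R -> R -> \bar R) (T : \bar R).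

Let fL : R -> R -> R := fun t1 t2 => fine (L t1 t2).

Definition regular_below : Prop :=
  [/\ forall t1 t2 : R, (t2%:E < T)%E -> L t1 t2 \is a fin_num,
      essentially_smooth (fun t : 'rV[R]_2 => L (t 0 0) (t 0 1)) &
      forall (a b : nat) (t1 t2 : R), (a + b <= 2)%N -> (t2%:E < T)%E ->
        partial_exists a b fL t1 t2].

Definition growth_bounded_below : Prop :=
  exists C : R -> R,
    [/\ {within [set t : R | (t%:E < T)%E], continuous C},
        forall t : R, (t%:E < T)%E -> 0 <= C t &
        forall (a b : nat) (t1 t2 : R), (a + b <= 2)%N -> (t2%:E < T)%E ->
          `|partial a b fL t1 t2| <= C t2 * (1 + `|t1| ^+ (2 - a))].

End assumptions.

Definition empirical_log_laplace (R : realType) (L : R -> R -> \bar R)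
    (n k : nat) (u : 'rV[R]_k) (A : 'M[R]_(n, k)) (c : R) : \bar R :=
  ((n%:R^-1)%:E *
     \sum_(i < n) L (inner u (Num.sqrt n%:R *: row i A)) c)%E.

(* Main.v *)
(** Under the Haar measure, the vector z with entries sqrt(n) <u, a_i> / D is
    uniformly distributed on the sphere of radius sqrt(n); the only property of
    its law mu used below is that the Laplace transform of mu is radial. With
    h(t) = Lambda(D t, c), which has at most quadratic growth and is locally
    Lipschitz with at most linearly growing constant, it suffices to bound
    mu(|n^-1 sum h(z_i) - E h(g)| >= e) by exp(- n I), and to conclude by a
    union bound over the d_n vectors and by Borel-Cantelli.

    Concentration is transferred from the product Gaussian by smoothing. Replace
    z by y = r z + s g with r^2 + s^2 = 1, s small and g standard Gaussian in R^n.
    Then n^-1 sum h(y_i) is close to n^-1 sum h(z_i), and |y|^2 is close to n,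
    with high probability. The density of y is an average over mu of
    exp(r <z, y> / s^2), up to a factor which is a function of |y|, so its ratio
    to the standard Gaussian density is a function of |y|, which varies by a
    factor at most exp(n e c) on the shell { ||y|^2 - n| < n e }. Both densities
    give mass at least 1/2 to the shell, so there the law of y is at most
    2 exp(n e c) times the Gaussian one. A small e makes this loss negligible with
    respect to the Cramer bound for sums of independent h(g_i). *)

Require Import Defs.
From HB Require Import structures.
From mathcomp Require Import all_boot all_order all_algebra finmap.
From mathcomp Require Import all_classical all_reals all_analysis measurable_realfun.
From mathcomp Require Import ring lra.

Set Implicit Arguments.
Unset Strict Implicit.
Unset Printing Implicit Defensive.

Import Order.TTheory GRing.Theory Num.Theory.
Import numFieldNormedType.Exports.

Local Open Scope classical_set_scope.
Local Open Scope ring_scope.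

(** * Finite powers of a measure *)

(* The library declares this as an instance, but the later instance for products
   of subprobabilities takes precedence and hides it from inference. *)
Lemma product_sigma_finite (R : realType) d1 d2 (T1 : measurableType d1)
    (T2 : measurableType d2) (m1 : {sigma_finite_measure set T1 -> \bar R})
    (m2 : {sigma_finite_measure set T2 -> \bar R}) :
  sigma_finite setT (m1 \x m2)%E.
Proof.
have [F FT mF] := sigma_finiteT m1; have [G GT mG] := sigma_finiteT m2.
pose p (k : nat) : nat * nat := odflt (0, 0)%N (choice.unpickle k).
exists (fun k => F (p k).1 `*` G (p k).2) => [|k].
  apply/seteqP; split=> // -[x y] _.
  have [i _ Fi] : (\bigcup_i F i) x by rewrite -FT.
  have [j _ Gj] : (\bigcup_i G i) y by rewrite -GT.
  by exists (choice.pickle (i, j)) => //=; rewrite /p choice.pickleK.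
have [mFk Fk] := mF (p k).1; have [mGk Gk] := mG (p k).2.
split; first exact: measurableX.
by rewrite product_measure1E// lte_mul_pinfty// ge0_fin_numE.
Qed.

(** Induction on [n] by Tonelli. The power is known only through integrals of products of
    one-coordinate functions: the Gaussian densities and the exponential weights used with them all
    factor in this way. *)
Lemma power_measure_exists (R : realType) dX (X : measurableType dX)
    (L : {sigma_finite_measure set X -> \bar R}) (n : nat) :
  exists (d : measure_display) (T : measurableType d)
    (G : {sigma_finite_measure set T -> \bar R}) (y : 'I_n -> T -> X),
  (forall i, measurable_fun setT (y i)) /\
  forall h : 'I_n -> X -> R,
    (forall i, measurable_fun setT (h i)) -> (forall i x, 0 <= h i x) ->
    (\int[G]_t (\prod_(i < n) h i (y i t))%:E =
     \prod_(i < n) \int[L]_x (h i x)%:E)%E.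
Proof.
elim: n => [|n [d [T [G [y [my Gy]]]]]].
  exists _, unit, (\d_tt : {sigma_finite_measure set unit -> \bar R}), (fun _ _ => point).
  split=> [i|h mh h0]; first exact: measurable_cst.
  rewrite !big_ord0.
  by rewrite integral_dirac// diracE in_setT mul1e.
pose M : {sigma_finite_measure set (X * T)%type -> \bar R} :=
  HB.pack (L \x G)%E
    (Measure_isSigmaFinite.Build _ _ _ (L \x G)%E (product_sigma_finite L G)).
exists _, (X * T)%type, M,
  (fun i p => if unlift ord0 i is Some j then y j p.2 else p.1).
split=> [i|h mh h0].
  case: (unliftP ord0 i) => [j _|_] /=; last exact: measurable_fst.
  by apply: measurableT_comp => //; exact: measurable_snd.
have E p : (\prod_(i < n.+1) h i (if unlift ord0 i is Some j then y j p.2 else p.1) =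
    h ord0 p.1 * \prod_(i < n) h (lift ord0 i) (y i p.2))%R.
  rewrite big_ord_recl unlift_none; congr (_ * _).
  by apply: eq_bigr => i _; rewrite liftK.
have m1 : measurable_fun setT (fun t => \prod_(i < n) h (lift ord0 i) (y i t)).
  by apply: measurable_prod => i _; exact: measurableT_comp.
under eq_integral do rewrite E.
rewrite (@fubini_tonelli1 _ _ _ _ _ L G); last 2 first.
- apply/measurable_EFinP; apply: measurable_funM.
    by apply: measurableT_comp => //; exact: measurable_fst.
  by apply: (measurableT_comp m1); exact: measurable_snd.
- by move=> p; rewrite lee_fin mulr_ge0// prodr_ge0.
rewrite /fubini_F /=.
under eq_integral => x _.
  under eq_integral do rewrite EFinM.
  rewrite ge0_integralZl//; last 3 first.
  - exact/measurable_EFinP.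
  - by move=> t _; rewrite lee_fin prodr_ge0.
  - by rewrite lee_fin.
  rewrite (Gy (fun i => h (lift ord0 i)))//.
  over.
rewrite big_ord_recl ge0_integralZr//.
- exact/measurable_EFinP.
- by move=> x _; rewrite lee_fin.
- by apply: prode_ge0 => i _; apply: integral_ge0 => x _; rewrite lee_fin.
Qed.

(** * Gaussian integrals *)

Lemma integral_normal_pdfM (R : realType) (m m' s s' C : R) (g : R -> R) :
  0 <= C -> (forall y, g y * normal_pdf m s y = C * normal_pdf m' s' y) ->
  (\int[lebesgue_measure]_y (g y * normal_pdf m s y)%:E = C%:E)%E.
Proof.
move=> C0 gE; under eq_integral do rewrite gE EFinM.
rewrite ge0_integralZl//.
- by rewrite integral_normal_pdf mule1.
- by apply/measurable_EFinP; exact: measurable_normal_pdf.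
- by move=> y _; rewrite lee_fin normal_pdf_ge0.
Qed.

Lemma normal_peak_scale (R : realType) (s u : R) : 0 < u ->
  normal_peak (s / Num.sqrt u) = Num.sqrt u * normal_peak s.
Proof.
move=> u0; rewrite /normal_peak expr_div_n sqr_sqrtr ?ltW//.
have -> : (s ^+ 2 / u * pi *+ 2 = u^-1 * (s ^+ 2 * pi *+ 2))%R.
  by ring.
by rewrite sqrtrM ?invr_ge0 ?ltW// invfM sqrtrV ?ltW// invrK.
Qed.

(** Completing the square: with u = 1 - 2 l s^2 the integrand is a constant multiple of the normal
    density with mean m + (a - m) / u and standard deviation s / sqrt(u). *)
Lemma normal_sqr_mgf (R : realType) (a m s l : R) : 0 < s ->
  0 < 1 - 2 * l * s ^+ 2 ->
  (\int[lebesgue_measure]_y (expR (l * (y - m) ^+ 2) * normal_pdf a s y)%:E =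
   ((Num.sqrt (1 - 2 * l * s ^+ 2))^-1 *
    expR (l * (a - m) ^+ 2 / (1 - 2 * l * s ^+ 2)))%:E)%E.
Proof.
move=> s0; set u := 1 - _ => u0.
have su : 0 < Num.sqrt u by rewrite sqrtr_gt0.
apply: (@integral_normal_pdfM _ _ (m + (a - m) / u) _ (s / Num.sqrt u)).
  by rewrite mulr_ge0 ?expR_ge0 ?invr_ge0 ?ltW.
move=> y; rewrite !normal_pdfE ?gt_eqF ?divr_gt0// normal_peak_scale//.
rewrite /normal_fun expr_div_n sqr_sqrtr ?(ltW u0)//.
(* Eliminating [l] in favour of [u] turns the comparison of exponents into a rational identity. *)
have lE : l = (1 - u) / (2 * s ^+ 2).
  by rewrite /u opprB addrC subrK; field; rewrite gt_eqF.
have /(congr1 expR) : l * (y - m) ^+ 2 + - (y - a) ^+ 2 / (s ^+ 2 *+ 2) =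
    l * (a - m) ^+ 2 / u +
    - (y - (m + (a - m) / u)) ^+ 2 / (s ^+ 2 / u *+ 2).
  by rewrite lE; field; rewrite !gt_eqF.
rewrite !expRD => E; rewrite mulrCA E; field; exact: lt0r_neq0.
Qed.

(** Squaring and inverting reduce the claim to exp(- (x + 2 x^2)) <= 1 - x. This follows from 1 + w
    <= exp(w) and (1 - x) (1 + x + 2 x^2) = 1 + x^2 (1 - 2 x) >= 1. *)
Lemma normal_mgf_bound (R : realType) (x : R) : `|x| <= 2^-1 ->
  (Num.sqrt (1 - x))^-1 <= expR (x / 2 + x ^+ 2).
Proof.
rewrite ler_norml => /andP[x1 x2].
rewrite -[leRHS]invrK -expRN lef_pV2 ?posrE ?expR_gt0 ?sqrtr_gt0; last by lra.
rewrite -(ger0_norm (expR_ge0 (- _))) -sqrtr_sqr ler_wsqrtr// -expRM_natl.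
have u0 : 0 < 1 + (x + 2 * x ^+ 2) by nra.
rewrite (_ : _ * - _ = - (x + 2 * x ^+ 2)); last by field.
rewrite expRN -[leRHS]invrK lef_pV2 ?posrE ?invr_gt0 ?expR_gt0//; last by lra.
apply: le_trans (expR_ge1Dx _).
rewrite -div1r ler_pdivrMr; last by lra.
  nra.
lra.
Qed.

(** * Exponential bounds under product Gaussian densities *)

(** A model of R^n with Lebesgue measure [G] and coordinate functions [y], characterised by its
    integrals of products. *)
Definition lebesgue_coords (R : realType) (n : nat) d (T : measurableType d)
    (G : {sigma_finite_measure set T -> \bar R}) (y : 'I_n -> T -> R) : Prop :=
  (forall i, measurable_fun setT (y i)) /\
  forall h : 'I_n -> R -> R,
    (forall i, measurable_fun setT (h i)) -> (forall i x, 0 <= h i x) ->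
    (\int[G]_t (\prod_(i < n) h i (y i t))%:E =
     \prod_(i < n) \int[lebesgue_measure]_x (h i x)%:E)%E.

Lemma lebesgue_coords_exists (R : realType) (n : nat) :
  exists (d : measure_display) (T : measurableType d)
    (G : {sigma_finite_measure set T -> \bar R}) (y : 'I_n -> T -> R),
  lebesgue_coords G y.
Proof. exact: (power_measure_exists (@lebesgue_measure R) n). Qed.

Lemma measurable_superlevel (R : realType) d (T : measurableType d)
    (f : T -> R) (c : R) :
  measurable_fun setT f -> measurable [set t | c <= f t].
Proof.
move=> mf; rewrite (_ : mkset _ = f @^-1` `[c, +oo[); last first.
  by apply/seteqP; split=> t /=; rewrite in_itv/= andbT.
by rewrite -[X in measurable X]setTI; exact: mf.
Qed.

(** The density of a + s g for g standard Gaussian in R^n. With a = r z it is the density of the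
    smoothed vector given z. *)
Definition gauss_dens (R : realType) (n : nat) (a : 'I_n -> R) (s : R)
    (y : 'I_n -> R) : R := \prod_(i < n) normal_pdf (a i) s (y i).

Lemma gauss_dens_ge0 (R : realType) n (a : 'I_n -> R) s y :
  0 <= gauss_dens a s y.
Proof. by apply: prodr_ge0 => i _; exact: normal_pdf_ge0. Qed.

Lemma measurable_gauss_dens (R : realType) n d (T : measurableType d)
    (a y : 'I_n -> T -> R) (s : R) : s != 0 ->
  (forall i, measurable_fun setT (a i)) -> (forall i, measurable_fun setT (y i)) ->
  measurable_fun setT (fun t => gauss_dens (a^~ t) s (y^~ t)).
Proof.
move=> s0 ma my; apply: measurable_prod => i _.
rewrite (_ : (fun _ => _) = normal_pdf 0 s \o (y i \- a i)).
  apply: measurableT_comp; first exact: measurable_normal_pdf.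
  exact: measurable_funB.
by apply/funext => t /=; rewrite !normal_pdfE// /normal_fun subr0.
Qed.

(** On [S] the weight exp(sum g_i) is at least 1. Inserting it and enlarging [S] to the whole space
    leaves an integral that factors. *)
Lemma lebesgue_coords_chernoff (R : realType) n d (T : measurableType d)
    (G : {sigma_finite_measure set T -> \bar R}) (y : 'I_n -> T -> R)
    (W g : 'I_n -> R -> R) (S : set T) :
  lebesgue_coords G y -> measurable S ->
  (forall i, measurable_fun setT (W i)) -> (forall i x, 0 <= W i x) ->
  (forall i, measurable_fun setT (g i)) ->
  (forall t, S t -> 0 <= \sum_(i < n) g i (y i t)) ->
  (\int[G]_(t in S) (\prod_(i < n) W i (y i t))%:E <=
   \prod_(i < n) \int[lebesgue_measure]_x (expR (g i x) * W i x)%:E)%E.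
Proof.
move=> [my Gy] mS mW W0 mg gS.
have mgW i : measurable_fun setT (fun x => expR (g i x) * W i x).
  by apply: measurable_funM => //; exact: measurableT_comp.
have gW0 i x : 0 <= expR (g i x) * W i x by rewrite mulr_ge0 ?expR_ge0.
rewrite -(Gy (fun i x => expR (g i x) * W i x))//.
have mP (h : 'I_n -> R -> R) : (forall i, measurable_fun setT (h i)) ->
    measurable_fun setT (fun t => (\prod_(i < n) h i (y i t))%:E).
  move=> mh; apply/measurable_EFinP/measurable_prod => i _.
  exact: (measurableT_comp (mh i) (my i)).
apply: (@le_trans _ _ (\int[G]_(t in S)
    (\prod_(i < n) (expR (g i (y i t)) * W i (y i t)))%:E)%E).
  apply: ge0_le_integral => //.
  - by move=> t _; rewrite lee_fin prodr_ge0.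
  - exact: measurable_funTS (mP _ mW).
  - exact: measurable_funTS (mP _ mgW).
  - move=> t St; rewrite lee_fin big_split/= ler_peMl ?prodr_ge0//.
    by rewrite -expR_sum -expR0 ler_expR gS.
apply: ge0_subset_integral => //.
- exact: mP mgW.
- by move=> t _; rewrite lee_fin prodr_ge0.
Qed.

Lemma integral_gauss_dens (R : realType) n d (T : measurableType d)
    (G : {sigma_finite_measure set T -> \bar R}) (y : 'I_n -> T -> R) a s :
  lebesgue_coords G y -> (\int[G]_t (gauss_dens a s (y^~ t))%:E = 1)%E.
Proof.
move=> [my Gy]; rewrite (Gy (fun i => normal_pdf (a i) s)).
- by apply: big1 => i _; exact: integral_normal_pdf.
- by move=> i; exact: measurable_normal_pdf.
- by move=> i x; exact: normal_pdf_ge0.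
Qed.

Lemma ge0_lee_prod (R : realType) n (F H : 'I_n -> \bar R) :
  (forall i, 0 <= F i <= H i)%E -> (\prod_(i < n) F i <= \prod_(i < n) H i)%E.
Proof.
move=> FH; suff /andP[] : (0 <= \prod_(i < n) F i <= \prod_(i < n) H i)%E by [].
apply: (big_ind2 (fun a b : \bar R => 0 <= a <= b)%E) => //=.
  by rewrite lexx lee01.
move=> a b c d /andP[a0 ab] /andP[c0 cd].
by rewrite mule_ge0//= lee_pmul.
Qed.

(** Chernoff bound with g_i(x) = l (x - m_i)^2 - b. The sign of [l] is free, so upper and lower
    tails are both covered; the last sum is the contribution of the centres. *)
Lemma gauss_dens_sqr_tail (R : realType) n d (T : measurableType d)
    (G : {sigma_finite_measure set T -> \bar R}) (y : 'I_n -> T -> R)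
    (a m : 'I_n -> R) (s l b : R) (S : set T) :
  lebesgue_coords G y -> measurable S -> 0 < s -> `|2 * l * s ^+ 2| <= 2^-1 ->
  (forall t, S t -> n%:R * b <= l * \sum_(i < n) (y i t - m i) ^+ 2) ->
  (\int[G]_(t in S) (gauss_dens a s (y^~ t))%:E <=
   (expR (n%:R * (l * s ^+ 2 + (2 * l * s ^+ 2) ^+ 2 - b) +
     l * \sum_(i < n) (a i - m i) ^+ 2 / (1 - 2 * l * s ^+ 2)))%:E)%E.
Proof.
move=> Gy mS s0; set x := 2 * l * s ^+ 2 => xl Sb.
have x1 : 0 < 1 - x by move: xl; rewrite ler_norml => /andP[_ ?]; lra.
pose g i z : R := l * (z - m i) ^+ 2 - b.
apply: le_trans (@lebesgue_coords_chernoff _ _ _ _ _ _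
    (fun i => normal_pdf (a i) s) g _ Gy mS _ _ _ _) _.
- by move=> i; exact: measurable_normal_pdf.
- by move=> i z; exact: normal_pdf_ge0.
- move=> i; apply: measurable_funB => //; apply: measurable_funM => //.
  by apply: measurable_funX; exact: measurable_funB.
- move=> t /Sb Sbt; rewrite /g sumrB -mulr_sumr subr_ge0.
  by rewrite sumr_const card_ord -mulr_natl.
have -> : expR (n%:R * (l * s ^+ 2 + x ^+ 2 - b) +
     l * \sum_(i < n) (a i - m i) ^+ 2 / (1 - x)) =
   \prod_(i < n) (expR (- b) * (expR (x / 2 + x ^+ 2) *
     expR (l * (a i - m i) ^+ 2 / (1 - x)))).
  under [in RHS]eq_bigr do rewrite -!expRD.
  rewrite -expR_sum !big_split/= !sumr_const card_ord.
  congr expR; rewrite mulr_sumr.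
  under [in RHS]eq_bigr do rewrite -mulrA.
  rewrite (_ : l * s ^+ 2 = x / 2); last by rewrite /x; field.
  by field.
rewrite -prodEFin; apply: ge0_lee_prod => i.
apply/andP; split.
  by apply: integral_ge0 => z _; rewrite lee_fin mulr_ge0 ?expR_ge0 ?normal_pdf_ge0.
under eq_integral do rewrite /g addrC expRD -mulrA EFinM.
rewrite ge0_integralZl//.
- rewrite normal_sqr_mgf// -EFinM lee_fin ler_wpM2l ?expR_ge0//.
  by rewrite ler_wpM2r ?expR_ge0// normal_mgf_bound.
- apply/measurable_EFinP/measurable_funM; last exact: measurable_normal_pdf.
  apply: measurableT_comp => //; apply: measurable_funM => //.
  by apply: measurable_funX; exact: measurable_funB.
- by move=> z _; rewrite lee_fin mulr_ge0 ?expR_ge0 ?normal_pdf_ge0.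
Qed.

Lemma ge0_integral_setU_le (R : realType) d (T : measurableType d)
    (mu : {measure set T -> \bar R}) (A B : set T) (f : T -> \bar R) :
  measurable A -> measurable B -> measurable_fun (A `|` B) f ->
  (forall x, 0 <= f x)%E ->
  (\int[mu]_(x in A `|` B) f x <=
   \int[mu]_(x in A) f x + \int[mu]_(x in B) f x)%E.
Proof.
move=> mA mB mf f0; have E : A `|` B = A `|` (B `\` A).
  by apply/seteqP; split=> x /=; case: (pselect (A x)); tauto.
rewrite E ge0_integral_setU -?E//.
- rewrite leeD2l// ge0_subset_integral//; first exact: measurableD.
  by apply: (measurable_funS _ _ mf); [exact: measurableU|exact: subsetUr].
- exact: measurableD.
- by apply/disj_setPS => x [? []].
Qed.

(** The multiplier 1 / (4 s^2) with b = 1 gives the exponent 1/4 + 1/4 - 1 = -1/2 per coordinate. *)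
Lemma gauss_dens_far (R : realType) n d (T : measurableType d)
    (G : {sigma_finite_measure set T -> \bar R}) (y : 'I_n -> T -> R)
    (a : 'I_n -> R) (s : R) :
  lebesgue_coords G y -> 0 < s ->
  (\int[G]_(t in [set t | (n%:R * (4 * s ^+ 2) <=
      \sum_(i < n) (y i t - a i) ^+ 2)%R]) (gauss_dens a s (y^~ t))%:E <=
   (expR (- (n%:R / 2)))%:E)%E.
Proof.
move=> Gy s0; have [my _] := Gy.
have x2 : 2 * (4 * s ^+ 2)^-1 * s ^+ 2 = 2^-1 :> R by field; rewrite gt_eqF.
apply: le_trans (@gauss_dens_sqr_tail _ _ _ _ _ _ a a s (4 * s ^+ 2)^-1 1 _
  Gy _ s0 _ _) _.
- apply: measurable_superlevel; apply: measurable_sum => i.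
  by apply: measurable_funX; exact: measurable_funB.
- by rewrite x2 ger0_norm// invr_ge0.
- move=> t /= yt; rewrite mulr1 mulrC ler_pdivlMr//.
  by rewrite mulr_gt0// exprn_gt0.
rewrite lee_fin ler_expR big1 => [|i _]; last by rewrite subrr expr0n mul0r.
rewrite mulr0 addr0 x2 (_ : _^-1 * _ = 4^-1); last by field; rewrite gt_eqF.
by have : (0 : R) <= n%:R by []; nra.
Qed.

(** The set is |y|^2 >= n (1 + 20 l) for l > 0 and |y|^2 <= n (1 + 20 l) for l < 0. Since r^2 + s^2
    = 1, the mean of |y|^2 is n, so the terms linear in [l] cancel and only a negative multiple of
    l^2 remains. *)
Lemma gauss_dens_sqr_deviation (R : realType) n d (T : measurableType d)
    (G : {sigma_finite_measure set T -> \bar R}) (y : 'I_n -> T -> R)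
    (z : 'I_n -> R) (r s l : R) :
  lebesgue_coords G y -> 0 < s -> r ^+ 2 + s ^+ 2 = 1 ->
  \sum_(i < n) z i ^+ 2 = n%:R -> `|l| <= 20^-1 ->
  (\int[G]_(t in [set t | (n%:R * (l + 20 * l ^+ 2) <=
      l * \sum_(i < n) y i t ^+ 2)%R])
     (gauss_dens (fun i => r * z i) s (y^~ t))%:E <=
   (expR (- (n%:R * (10 * l ^+ 2))))%:E)%E.
Proof.
move=> Gy s0 rs zn; rewrite ler_norml => /andP[l1 l2]; have [my _] := Gy.
have s20 : 0 < s ^+ 2 by rewrite exprn_gt0.
have r20 : 0 <= r ^+ 2 by rewrite sqr_ge0.
have l20 : 0 <= l ^+ 2 by rewrite sqr_ge0.
have xl : `|2 * l * s ^+ 2| <= 2^-1 by rewrite ler_norml; apply/andP; split; nra.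
apply: le_trans (@gauss_dens_sqr_tail _ _ _ _ _ _ (fun i => r * z i)
  (fun=> 0) s l (l + 20 * l ^+ 2) _ Gy _ s0 xl _) _.
- apply: measurable_superlevel; apply: measurable_funM => //.
  by apply: measurable_sum => i; exact: measurable_funX.
- by move=> t; under eq_bigr do rewrite subr0.
rewrite lee_fin ler_expR.
under eq_bigr do rewrite subr0 exprMn mulrAC.
rewrite -mulr_sumr zn.
have u0 : 0 < 1 - 2 * l * s ^+ 2.
  by move: xl; rewrite ler_norml => /andP[_ ?]; lra.
have rE : r ^+ 2 = 1 - s ^+ 2 by rewrite -rs addrK.
have l3 : l * l ^+ 2 <= 20^-1 * l ^+ 2 by rewrite ler_wpM2r.
have l3' : - (20^-1 * l ^+ 2) <= l * l ^+ 2 by rewrite -mulNr ler_wpM2r.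
have s1 : s ^+ 2 <= 1 by lra.
have l2s : l ^+ 2 * s ^+ 2 <= l ^+ 2 by rewrite ler_piMr.
have l2ss : l ^+ 2 * s ^+ 2 * s ^+ 2 <= l ^+ 2 * s ^+ 2.
  by rewrite ler_piMr// mulr_ge0// ltW.
(* First-order expansion in [l] of the contribution of the centres. *)
have key : l * (r ^+ 2 / (1 - 2 * l * s ^+ 2)) <= l * r ^+ 2 + 4 * l ^+ 2.
  rewrite mulrA ler_pdivrMr// rE.
  have : l * l ^+ 2 * s ^+ 2 <= 20^-1 * l ^+ 2 * s ^+ 2.
    by rewrite ler_wpM2r// ltW.
  by nra.
rewrite (_ : l * (_ * n%:R) = n%:R * (l * (r ^+ 2 / (1 - 2 * l * s ^+ 2)))); last by ring.
rewrite -mulrDr -[leRHS]mulrN ler_wpM2l//.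
by move: key; rewrite rE; nra.
Qed.

(** The two signs l = e/20 and l = -e/20 give the thresholds 1 + e and 1 - e, with 10 l^2 = e^2 /
    40. The rate does not depend on [s], which allows [e] to be chosen after [s]. *)
Lemma gauss_dens_shell (R : realType) n d (T : measurableType d)
    (G : {sigma_finite_measure set T -> \bar R}) (y : 'I_n -> T -> R)
    (z : 'I_n -> R) (r s e : R) :
  lebesgue_coords G y -> 0 < s -> r ^+ 2 + s ^+ 2 = 1 ->
  \sum_(i < n) z i ^+ 2 = n%:R -> 0 < e <= 1 ->
  (\int[G]_(t in [set t | (n%:R * e <= `|\sum_(i < n) y i t ^+ 2 - n%:R|)%R])
     (gauss_dens (fun i => r * z i) s (y^~ t))%:E <=
   (2 * expR (- (n%:R * (e ^+ 2 / 40))))%:E)%E.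
Proof.
move=> Gy s0 rs zn /andP[e0 e1]; have [my _] := Gy.
have mq : measurable_fun setT (fun t => \sum_(i < n) y i t ^+ 2).
  by apply: measurable_sum => i; exact: measurable_funX.
have mD A : measurable_fun A
    (fun t => (gauss_dens (fun i => r * z i) s (y^~ t))%:E).
  apply: measurable_funTS; apply/measurable_EFinP.
  by apply: (@measurable_gauss_dens _ _ _ _ (fun i _ => r * z i)); rewrite ?gt_eqF.
pose S l := [set t | n%:R * (l + 20 * l ^+ 2) <= l * \sum_(i < n) y i t ^+ 2].
have mS l : measurable (S l).
  by apply: measurable_superlevel; exact: measurable_funM.
have dev l : `|l| <= 20^-1 -> 10 * l ^+ 2 = e ^+ 2 / 40 ->
    (\int[G]_(t in S l) (gauss_dens (fun i => r * z i) s (y^~ t))%:E <=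
     (expR (- (n%:R * (e ^+ 2 / 40))))%:E)%E.
  by move=> l1 <-; exact: gauss_dens_sqr_deviation.
have e20 : `|e / 20| <= 20^-1 by rewrite ger0_norm; lra.
apply: (@le_trans _ _ (\int[G]_(t in S (e / 20)%R)
    (gauss_dens (fun i => r * z i) s (y^~ t))%:E +
  \int[G]_(t in S (- (e / 20))%R) (gauss_dens (fun i => r * z i) s (y^~ t))%:E)%E).
  apply: (@le_trans _ _ (\int[G]_(t in S (e / 20)%R `|` S (- (e / 20))%R)
      (gauss_dens (fun i => r * z i) s (y^~ t))%:E)%E).
    apply: ge0_subset_integral => //.
    - by apply: measurable_superlevel; apply: measurableT_comp => //;
        exact: measurable_funB.
    - exact: measurableU.
    - by move=> t _; rewrite lee_fin gauss_dens_ge0.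
    - by move=> t /=; rewrite /S/= ler_normr => /orP[] h; [left|right]; nra.
  apply: ge0_integral_setU_le => //.
  by move=> t; rewrite lee_fin gauss_dens_ge0.
rewrite mulr2n mulrDl mul1r EFinD leeD//; apply: dev; rewrite ?normrN//; by field.
Qed.

(** * Cramer bound for functions of quadratic growth *)

Lemma expR_le_quadratic (R : realType) (x : R) :
  expR x <= 1 + x + x ^+ 2 * expR `|x|.
Proof.
have h1 : expR x - 1 <= x * expR x.
  have := expR_ge1Dx (- x); rewrite -(ler_pM2r (expR_gt0 x)) expRN.
  by rewrite mulVf ?gt_eqF ?expR_gt0// mulrDl mul1r mulNr; lra.
have h2 : x * (expR x - 1) <= x ^+ 2 * expR `|x|.
  have [x0|x0] := leP 0 x.
    by rewrite ger0_norm// expr2 -mulrA ler_wpM2l.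
  have h3 := expR_ge1Dx x.
  apply: (@le_trans _ _ (x ^+ 2)); first by nra.
  by rewrite ler_peMr ?sqr_ge0// -expR0 ler_expR.
by lra.
Qed.

Lemma sqr_le_expR (R : realType) (x : R) : 0 <= x -> x ^+ 2 <= 4 * expR x.
Proof.
move=> x0; have : (1 + x / 2) ^+ 2 <= expR (x / 2) ^+ 2.
  by rewrite ler_pXn2r ?nnegrE ?expR_ge0 ?expR_ge1Dx//; lra.
rewrite -expRM_natl (_ : 2 * (x / 2) = x); last by field.
by nra.
Qed.

Lemma integral_expR_sqr_normal (R : realType) :
  (\int[lebesgue_measure]_x (expR (x ^+ 2 / 4) * normal_pdf (0 : R) 1 x)%:E =
   ((Num.sqrt 2^-1)^-1)%:E)%E.
Proof.
have u : 1 - 2 * 4^-1 * 1 ^+ 2 = 2^-1 :> R by field.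
have := @normal_sqr_mgf R 0 0 1 4^-1 ltr01.
rewrite u subr0 expr0n mulr0 mul0r expR0 mulr1 => /(_ _) <-.
  by apply: eq_integral => x _; rewrite subr0 [_ / 4]mulrC.
by rewrite invr_gt0.
Qed.

Lemma integrable_expR_sqr_normal (R : realType) :
  (@lebesgue_measure R).-integrable setT
    (fun x => (expR (x ^+ 2 / 4) * normal_pdf 0 1 x)%:E).
Proof.
apply/integrableP; split.
  apply/measurable_EFinP/measurable_funM; last exact: measurable_normal_pdf.
  by apply: measurableT_comp => //; apply: measurable_funM => //; exact: measurable_funX.
under eq_integral do rewrite gee0_abs ?lee_fin ?mulr_ge0 ?expR_ge0 ?normal_pdf_ge0//.
by rewrite integral_expR_sqr_normal ltry.
Qed.

Lemma integrable_quadratic_normal (R : realType) (h : R -> R) (C : R) :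
  measurable_fun setT h -> (forall x, `|h x| <= C * (1 + x ^+ 2)) ->
  (@lebesgue_measure R).-integrable setT (fun x => (h x * normal_pdf 0 1 x)%:E).
Proof.
move=> mh hC.
have C0 : 0 <= C by have := le_trans (normr_ge0 _) (hC 0); rewrite expr0n addr0 mulr1.
have ig := integrableZl measurableT (4 * C) (integrable_expR_sqr_normal R).
apply: (le_integrable measurableT _ _ ig).
- by apply/measurable_EFinP/measurable_funM => //; exact: measurable_normal_pdf.
- move=> x _; rewrite -EFinM lee_fin !normrM.
  rewrite (ger0_norm (normal_pdf_ge0 _ _ _)) (ger0_norm (expR_ge0 _)).
  rewrite (ger0_norm C0) (ger0_norm (_ : 0 <= 4))// mulrA ler_wpM2r ?normal_pdf_ge0//.
  apply: le_trans (hC x) _; rewrite (mulrC 4) -mulrA ler_wpM2l//.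
  by have := expR_ge1Dx (x ^+ 2 / 4); have := sqr_ge0 x; lra.
Qed.

(** Integrating exp(l (h - m)) <= 1 + l (h - m) + l^2 K0 exp(x^2 / 4) removes the linear term, which
    leaves at most 1 + l^2 K <= exp(l^2 K). With l K <= e/2 the exponent -l e + l^2 K is at most -l
    e / 2. *)
Lemma quadratic_normal_cramer (R : realType) (h : R -> R) (C m e : R) :
  measurable_fun setT h -> 0 < C -> (forall x, `|h x| <= C * (1 + x ^+ 2)) ->
  (\int[lebesgue_measure]_x (h x * normal_pdf 0 1 x)%:E = m%:E)%E -> 0 < e ->
  exists l I : R, [/\ 0 < l, 0 < I &
   (\int[lebesgue_measure]_x
      (expR (l * (h x - (m + e))) * normal_pdf 0 1 x)%:E <= (expR (- I))%:E)%E].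
Proof.
move=> mh C0 hC hm e0.
pose c := C + `|m|; have c0 : 0 < c by rewrite ltr_pwDl.
(* Then l0 |h - m| <= (1 + x^2) / 8. The remainder costs this exponent twice, once to absorb the
   square (h - m)^2, hence exp(1/4) exp(x^2 / 4). *)
pose l0 := (8 * c)^-1; have l00 : 0 < l0 by rewrite invr_gt0 mulr_gt0.
pose K0 := 4 * l0 ^- 2 * expR (4^-1 : R).
have K00 : 0 < K0 by rewrite !mulr_gt0 ?expR_gt0// invr_gt0 exprn_gt0.
pose K := K0 * (Num.sqrt (2^-1 : R))^-1.
have K1 : 0 < K by rewrite mulr_gt0// invr_gt0 sqrtr_gt0 invr_gt0.
pose l := Order.min l0 (e / (2 * K)).
have l_gt0 : 0 < l by rewrite lt_min l00/= divr_gt0// mulr_gt0.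
have ll0 : l <= l0 by rewrite ge_min lexx.
have lK : l * K <= e / 2.
  apply: (@le_trans _ _ (e / (2 * K) * K)); last first.
    by rewrite le_eqVlt; apply/orP; left; apply/eqP; field; rewrite gt_eqF.
  by rewrite ler_pM2r// ge_min lexx orbT.
exists l, (l * e / 2); split=> //; first by rewrite divr_gt0// mulr_gt0.
have pw x : expR (l * (h x - m)) <=
    1 + l * (h x - m) + l ^+ 2 * K0 * expR (x ^+ 2 / 4).
  apply: le_trans (expR_le_quadratic _) _; rewrite lerD2l.
  have kc : l0 * `|h x - m| <= (1 + x ^+ 2) / 8.
    rewrite /l0 mulrC ler_pdivrMr ?mulr_gt0//.
    apply: le_trans (ler_normB _ _) _; have := hC x; have := sqr_ge0 x.
    by have := normr_ge0 m; rewrite /c; nra.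
  rewrite exprMn -!(mulrA (l ^+ 2)) ler_wpM2l ?sqr_ge0//.
  have k2 : (h x - m) ^+ 2 <= 4 * l0 ^- 2 * expR (l0 * `|h x - m|).
    have := sqr_le_expR (mulr_ge0 (ltW l00) (normr_ge0 (h x - m))).
    rewrite exprMn real_normK ?num_real// => k2.
    by rewrite mulrAC ler_pdivlMr ?exprn_gt0// mulrC.
  apply: (@le_trans _ _ (4 * l0 ^- 2 * expR (l0 * `|h x - m|) *
      expR (l0 * `|h x - m|))).
    apply: ler_pM; rewrite ?sqr_ge0 ?expR_ge0// ler_expR normrM.
    by rewrite (ger0_norm (ltW l_gt0)) ler_wpM2r.
  rewrite /K0 -2!(mulrA (4 * l0 ^- 2)) -!expRD ler_wpM2l//.
    by rewrite mulr_ge0// invr_ge0 exprn_ge0// ltW.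
  by rewrite ler_expR; lra.
have ih := integrable_quadratic_normal mh hC.
have ip := @integrable_normal_pdf R 0 1.
have ie := integrable_expR_sqr_normal R.
have mp := @measurable_normal_pdf R 0 1.
have mk a b : measurable_fun setT (fun x => (expR (a * (h x - b)) * normal_pdf 0 1 x)%:E).
  apply/measurable_EFinP/measurable_funM => //; apply: measurableT_comp => //.
  by apply: measurable_funM => //; exact: measurable_funB.
under eq_integral => x _.
  rewrite (_ : _ * _ = expR (- (l * e)) * (expR (l * (h x - m)) * normal_pdf 0 1 x)).
    rewrite EFinM; over.
  by rewrite mulrA -expRD; congr (expR _ * _); ring.
rewrite ge0_integralZl//; last first.
- by move=> x _; rewrite lee_fin mulr_ge0 ?expR_ge0 ?normal_pdf_ge0.
- exact: mk.
apply: (@le_trans _ _ ((expR (- (l * e)))%:E * (1 + l ^+ 2 * K)%:E)%E); last first.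
  rewrite -EFinM lee_fin.
  apply: (@le_trans _ _ (expR (- (l * e)) * expR (l ^+ 2 * K))).
    by rewrite ler_wpM2l ?expR_ge0// expR_ge1Dx.
  by rewrite -expRD ler_expR; nra.
rewrite lee_wpmul2l ?lee_fin ?expR_ge0//.
apply: (@le_trans _ _ (\int[lebesgue_measure]_x
  (((1 - l * m)%:E * (normal_pdf 0 1 x)%:E + l%:E * (h x * normal_pdf 0 1 x)%:E) +
   (l ^+ 2 * K0)%:E * (expR (x ^+ 2 / 4) * normal_pdf 0 1 x)%:E))%E).
  apply: ge0_le_integral => //.
  - by move=> x _; rewrite lee_fin mulr_ge0 ?expR_ge0 ?normal_pdf_ge0.
  - exact: mk.
  - apply: emeasurable_funD; last exact: measurable_funeM (measurable_int _ ie).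
    apply: emeasurable_funD; apply: measurable_funeM.
      exact: (measurable_int _ ip).
    exact: (measurable_int _ ih).
  - move=> x _; rewrite -!EFinM -!EFinD lee_fin.
    by have := ler_wpM2r (normal_pdf_ge0 0 1 x) (pw x); lra.
rewrite integralD//; last 2 first.
  by apply: integrableD => //; exact: integrableZl.
  exact: integrableZl.
rewrite integralD//; [|exact: integrableZl..].
rewrite !integralZl// integral_normal_pdf hm integral_expR_sqr_normal.
rewrite -!EFinM -!EFinD lee_fin /K; lra.
Qed.

(** The one-sided bound is applied to h and to -h. The rate is fixed before [n]. *)
Lemma gauss_mean_tail (R : realType) (h : R -> R) (C m e : R) :
  measurable_fun setT h -> 0 < C -> (forall x, `|h x| <= C * (1 + x ^+ 2)) ->
  (\int[lebesgue_measure]_x (h x * normal_pdf 0 1 x)%:E = m%:E)%E -> 0 < e ->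
  exists2 I : R, 0 < I & forall n d (T : measurableType d)
    (G : {sigma_finite_measure set T -> \bar R}) (y : 'I_n -> T -> R),
  lebesgue_coords G y ->
  (\int[G]_(t in [set t | (n%:R * e <= `|\sum_(i < n) h (y i t) - n%:R * m|)%R])
     (gauss_dens (fun=> 0) 1 (y^~ t))%:E <= (2 * expR (- (n%:R * I)))%:E)%E.
Proof.
have half (g : R -> R) (b : R) : measurable_fun setT g -> 0 < C ->
    (forall x, `|g x| <= C * (1 + x ^+ 2)) ->
    (\int[lebesgue_measure]_x (g x * normal_pdf 0 1 x)%:E = b%:E)%E -> 0 < e ->
    exists2 I : R, 0 < I & forall n d (T : measurableType d)
      (G : {sigma_finite_measure set T -> \bar R}) (y : 'I_n -> T -> R),
    lebesgue_coords G y ->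
    (\int[G]_(t in [set t | (n%:R * (b + e) <= \sum_(i < n) g (y i t))%R])
       (gauss_dens (fun=> 0) 1 (y^~ t))%:E <= (expR (- (n%:R * I)))%:E)%E.
  move=> mg C0 gC gb e0.
  have [l [I [l0 I0 lI]]] := quadratic_normal_cramer mg C0 gC gb e0.
  exists I => // n d T G y Gy; have [my _] := Gy.
  apply: le_trans (@lebesgue_coords_chernoff _ _ _ _ _ _
    (fun=> normal_pdf 0 1) (fun _ x => l * (g x - (b + e))) _ Gy _ _ _ _ _) _.
  - apply: measurable_superlevel; apply: measurable_sum => i.
    exact: measurableT_comp.
  - by move=> i; exact: measurable_normal_pdf.
  - by move=> i x; exact: normal_pdf_ge0.
  - by move=> i; apply: measurable_funM => //; exact: measurable_funB.
  - move=> t /= tS; rewrite -mulr_sumr; apply: mulr_ge0; first exact: ltW.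
    by rewrite sumrB subr_ge0 sumr_const card_ord -mulr_natl.
  rewrite (_ : expR _ = \prod_(i < n) expR (- I)); last first.
    by rewrite -expR_sum sumr_const card_ord mulNrn mulr_natl.
  rewrite -prodEFin; apply: ge0_lee_prod => i; rewrite lI andbT.
  by apply: integral_ge0 => x _; rewrite lee_fin mulr_ge0 ?expR_ge0 ?normal_pdf_ge0.
move=> mh C0 hC hm e0.
have [I1 I10 h1] := half h m mh C0 hC hm e0.
have mNh : measurable_fun setT (fun x => - h x) by exact: measurableT_comp.
have NhC x : `|- h x| <= C * (1 + x ^+ 2) by rewrite normrN.
have Nhm : (\int[lebesgue_measure]_x (- h x * normal_pdf 0 1 x)%:E = (- m)%:E)%E.
  under eq_integral do rewrite mulNr EFinN.
  rewrite integralN/= ?hm//.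
  apply: integrable_add_def => //.
  exact: (integrable_quadratic_normal mh hC).
have [I2 I20 h2] := half _ _ mNh C0 NhC Nhm e0.
exists (Order.min I1 I2) => [|n d T G y Gy]; first by rewrite lt_min I10.
have [my _] := Gy.
have mS (g : R -> R) : measurable_fun setT g ->
    measurable_fun setT (fun t => \sum_(i < n) g (y i t)).
  by move=> mg; apply: measurable_sum => i; exact: measurableT_comp.
have mD A : measurable_fun A (fun t => (gauss_dens (fun=> (0 : R)) 1 (y^~ t))%:E).
  apply: measurable_funTS; apply/measurable_EFinP.
  by apply: (@measurable_gauss_dens _ _ _ _ (fun _ _ => 0)); rewrite ?oner_neq0.
have D0 t : (0 <= (gauss_dens (fun=> (0 : R)) 1 (y^~ t))%:E)%E.
  by rewrite lee_fin gauss_dens_ge0.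
pose A1 := [set t | n%:R * (m + e) <= \sum_(i < n) h (y i t)].
pose A2 := [set t | n%:R * (- m + e) <= \sum_(i < n) - h (y i t)].
have mA1 : measurable A1 by apply: measurable_superlevel; exact: mS.
have mA2 : measurable A2 by apply: measurable_superlevel; exact: (mS (fun x => - h x)).
apply: (@le_trans _ _ (\int[G]_(t in A1 `|` A2)
    (gauss_dens (fun=> 0%R) 1%R (y^~ t))%:E)%E).
  apply: ge0_subset_integral => //.
  - apply: measurable_superlevel; apply: measurableT_comp => //.
    by apply: measurable_funB => //; exact: mS.
  - exact: measurableU.
  - move=> t /=; rewrite /A1 /A2/= sumrN ler_normr => /orP[] h0; [left|right]; lra.
apply: le_trans (ge0_integral_setU_le _ mA1 mA2 (mD _) D0) _.
rewrite mulr2n mulrDl mul1r EFinD leeD//.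
  apply: le_trans (h1 _ _ _ _ _ Gy) _.
  by rewrite lee_fin ler_expR lerN2 ler_wpM2l// ge_min lexx.
apply: le_trans (h2 _ _ _ _ _ Gy) _.
by rewrite lee_fin ler_expR lerN2 ler_wpM2l// ge_min lexx orbT.
Qed.

(* Weighted AM-GM with weight s on (1 + |y| + |z|) |y - z|. *)
Lemma mean_perturbation (R : realType) n (h : R -> R) (C r s : R)
    (y z : 'I_n -> R) :
  0 < C -> (forall u v, `|h u - h v| <= C * (1 + `|u| + `|v|) * `|u - v|) ->
  0 <= r -> 0 < s -> r ^+ 2 + s ^+ 2 = 1 ->
  \sum_(i < n) z i ^+ 2 = n%:R -> \sum_(i < n) y i ^+ 2 <= n%:R * 2 ->
  \sum_(i < n) (y i - r * z i) ^+ 2 <= n%:R * (4 * s ^+ 2) ->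
  `|\sum_(i < n) h (y i) - \sum_(i < n) h (z i)| <= n%:R * (11 * C * s).
Proof.
move=> C0 hC r0 s0 rs zn yn far.
have s1 : s <= 1 by nra.
have r1 : r <= 1 by nra.
(* From s^2 = (1 - r) (1 + r): shrinking z to r z costs no more than the noise of size [s]. *)
have r1s : (1 - r) ^+ 2 <= s ^+ 2 by nra.
rewrite -sumrB; apply: le_trans (ler_norm_sum _ _ _) _.
apply: (@le_trans _ _ (\sum_(i < n) C * (3 / 2 * s * (1 + y i ^+ 2 + z i ^+ 2) +
   s^-1 * ((y i - r * z i) ^+ 2 + s ^+ 2 * z i ^+ 2)))).
  apply: ler_sum => i _; apply: le_trans (hC _ _) _.
  rewrite -mulrA ler_pM2l//.
  set Y := y i; set Z := z i.
  have h1 : (1 + `|Y| + `|Z|) ^+ 2 <= 3 * (1 + Y ^+ 2 + Z ^+ 2).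
    rewrite -(real_normK (num_real Y)) -(real_normK (num_real Z)).
    have := sqr_ge0 (`|Y| - `|Z|); have := sqr_ge0 (`|Y| - 1).
    by have := sqr_ge0 (`|Z| - 1); nra.
  have h2 : `|Y - Z| ^+ 2 <= 2 * ((Y - r * Z) ^+ 2 + s ^+ 2 * Z ^+ 2).
    rewrite real_normK ?num_real//.
    have := sqr_ge0 ((Y - r * Z) + (1 - r) * Z).
    have : (1 - r) ^+ 2 * Z ^+ 2 <= s ^+ 2 * Z ^+ 2 by rewrite ler_wpM2r ?sqr_ge0.
    by nra.
  rewrite -(ler_pM2l s0) mulrDr (mulrA s s^-1) divff ?gt_eqF// mul1r.
  have := sqr_ge0 (s * (1 + `|Y| + `|Z|) - `|Y - Z|).
  have : s ^+ 2 * (1 + `|Y| + `|Z|) ^+ 2 <= s ^+ 2 * (3 * (1 + Y ^+ 2 + Z ^+ 2)).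
    by rewrite ler_wpM2l ?sqr_ge0.
  by nra.
rewrite -mulr_sumr big_split/= -!mulr_sumr !big_split/= -!mulr_sumr zn.
rewrite sumr_const card_ord.
(* 11 = 6 + 5: the sum of 1 + y_i^2 + z_i^2 is at most 4 n, and that of (y_i - r z_i)^2 + s^2 z_i^2
   at most 5 s^2 n. *)
rewrite (_ : n%:R * (11 * C * s) =
  C * (3 / 2 * s * (4 * n%:R) + s^-1 * (5 * s ^+ 2 * n%:R))); last first.
  by field; rewrite gt_eqF.
rewrite ler_pM2l//; apply: lerD.
  by apply: ler_wpM2l; lra.
by rewrite ler_pM2l ?invr_gt0//; lra.
Qed.

(** * Comparison of the sphere with the Gaussian *)

Definition radial (R : realType) n d (Om : measurableType d)
    (mu : {measure set Om -> \bar R}) (z : 'I_n -> Om -> R) : Prop :=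
  forall v w : 'I_n -> R, \sum_(i < n) v i ^+ 2 = \sum_(i < n) w i ^+ 2 ->
  (\int[mu]_x (expR (\sum_(i < n) z i x * v i))%:E =
   \int[mu]_x (expR (\sum_(i < n) z i x * w i))%:E)%E.

Lemma gauss_densE (R : realType) n (a y : 'I_n -> R) (s : R) : s != 0 ->
  gauss_dens a s y =
  normal_peak s ^+ n * expR (- (\sum_(i < n) (y i - a i) ^+ 2 / (2 * s ^+ 2))).
Proof.
move=> s0; rewrite /gauss_dens -sumrN expR_sum.
under [LHS]eq_bigr do rewrite normal_pdfE//.
rewrite big_split/= prodr_const card_ord; congr (_ * _).
by apply: eq_bigr => i _; rewrite /normal_fun mulNr mulr_natl.
Qed.

(** The ratio of the mixture density to the Gaussian one at two points of the shell,
    cross-multiplied so that it can be integrated in y' without division. *)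
Lemma radial_mix_ratio (R : realType) n d (Om : measurableType d)
    (mu : {measure set Om -> \bar R}) (z : 'I_n -> Om -> R) (r s e : R)
    (y y' : 'I_n -> R) :
  (0 < n)%N -> radial mu z -> (forall i, measurable_fun setT (z i)) ->
  (forall x, \sum_(i < n) z i x ^+ 2 = n%:R) ->
  0 <= r <= 1 -> 0 < s -> 0 < e <= 2^-1 ->
  `|\sum_(i < n) y i ^+ 2 - n%:R| <= n%:R * e ->
  `|\sum_(i < n) y' i ^+ 2 - n%:R| <= n%:R * e ->
  (\int[mu]_x (gauss_dens (fun i => r * z i x) s y)%:E *
     (gauss_dens (fun=> 0) 1 y')%:E <=
   (expR (n%:R * e * (6 / s ^+ 2 + 1)) * gauss_dens (fun=> 0) 1 y)%:E *
     \int[mu]_x (gauss_dens (fun i => r * z i x) s y')%:E)%E.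
Proof.
move=> n_gt0 rz mz zn /andP[r0 r1] s0 /andP[e0 e1].
have s20 : 0 < s ^+ 2 by rewrite exprn_gt0.
have n0 : (0 : R) < n%:R by rewrite ltr0n.
set Y := \sum_(i < n) y i ^+ 2; set Y' := \sum_(i < n) y' i ^+ 2.
rewrite !ler_norml => /andP[yl yr] /andP[y'l y'r].
pose b := r / s ^+ 2.
have b0 : 0 <= b by rewrite divr_ge0// ltW.
have bs : b <= s ^- 2 by rewrite ler_piMl// invr_ge0 ltW.
(* Expanding |y - r z|^2 with |z|^2 = n leaves this function of |y|^2 and the cross term b <z,
   y>. *)
pose A (X : R) := normal_peak s ^+ n * expR (- ((X + r ^+ 2 * n%:R) / (2 * s ^+ 2))).
have A0 X : 0 <= A X by rewrite mulr_ge0 ?expR_ge0// exprn_ge0// normal_peak_ge0.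
have mE w : measurable_fun setT (fun x => (expR (\sum_(i < n) z i x * w i))%:E).
  apply/measurable_EFinP; apply: measurableT_comp => //.
  by apply: measurable_sum => i; exact: measurable_funM.
have E0 w x : (0 <= (expR (\sum_(i < n) z i x * w i))%:E)%E by rewrite lee_fin expR_ge0.
have qE w : (\int[mu]_x (gauss_dens (fun i => r * z i x) s w)%:E =
    (A (\sum_(i < n) w i ^+ 2))%:E *
    \int[mu]_x (expR (\sum_(i < n) z i x * (b * w i)))%:E)%E.
  rewrite -ge0_integralZl//; last exact: A0.
  apply: eq_integral => x _; rewrite -EFinM; congr (_%:E).
  rewrite gauss_densE ?gt_eqF// /A -mulrA -expRD; congr (_ * expR _).
  rewrite -(zn x) mulr_sumr -big_split/= mulr_suml -!sumrN -big_split/=.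
  by apply: eq_bigr => i _; rewrite /b; field; rewrite gt_eqF.
have gE w : gauss_dens (fun=> 0) 1 w =
    normal_peak 1 ^+ n * expR (- ((\sum_(i < n) w i ^+ 2) / 2)).
  rewrite gauss_densE ?oner_neq0// mulr_suml; congr (_ * expR (- _)).
  by apply: eq_bigr => i _; rewrite subr0 expr1n mulr1.
have Y'0 : 0 < Y' by nra.
(* Radiality lets t y' replace y, and t is close to 1 in the shell. *)
pose t := Num.sqrt (Y / Y').
have Y0 : 0 < Y by nra.
have t0 : 0 <= t by exact: sqrtr_ge0.
have t2 : t ^+ 2 * Y' = Y.
  by rewrite sqr_sqrtr ?divr_ge0 ?ltW// divfK ?gt_eqF.
(* Uses |t - 1| <= |t^2 - 1|, |Y - Y'| <= 2 e n and Y' >= n/2. *)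
have tY : (t - 1) ^+ 2 * Y' <= 8 * e ^+ 2 * n%:R.
  have h1 : (t - 1) ^+ 2 * Y' <= (t ^+ 2 - 1) ^+ 2 * Y'.
    rewrite ler_pM2r//; have := sqr_ge0 (t - 1).
    rewrite (_ : (t ^+ 2 - 1) ^+ 2 = (t - 1) ^+ 2 * (t + 1) ^+ 2); last by ring.
    by move=> ?; rewrite ler_peMr//; nra.
  apply: le_trans h1 _; rewrite -(ler_pM2r Y'0).
  rewrite (_ : _ * Y' * Y' = (t ^+ 2 * Y' - Y') ^+ 2); last by ring.
  rewrite t2; have h2 : (Y - Y') ^+ 2 <= (2 * e * n%:R) ^+ 2.
    rewrite -[leLHS]real_normK ?num_real// ler_pXn2r ?nnegrE//; first last.
    - by rewrite mulr_ge0 ?mulr_ge0// ltW.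
    - by rewrite ler_norml; apply/andP; split; lra.
  by apply: le_trans h2 _; have : 0 <= e ^+ 2 * n%:R; nra.
have mix : (\int[mu]_x (expR (\sum_(i < n) z i x * (b * y i)))%:E <=
    (expR (5 * b * e * n%:R))%:E *
    \int[mu]_x (expR (\sum_(i < n) z i x * (b * y' i)))%:E)%E.
  rewrite (rz _ (fun i => b * (t * y' i))); last first.
    under eq_bigr do rewrite exprMn.
    under [RHS]eq_bigr do rewrite mulrA exprMn.
    by rewrite -!mulr_sumr -/Y -/Y' [(b * t) ^+ 2]exprMn -(mulrA (b ^+ 2)) t2.
  rewrite -ge0_integralZl ?lee_fin ?expR_ge0//.
  apply: ge0_le_integral => //.
  - by apply: measurable_funeM; exact: (mE (fun i => b * y' i)).
  - move=> x _; rewrite -EFinM -expRD lee_fin ler_expR -lerBlDr -sumrB.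
    (* AM-GM with weight [e]: the two sums are at most e n / 2 and 8 e^2 n / (2 e) = 4 e n, together
       below 5 e n. *)
    apply: (@le_trans _ _ (\sum_(i < n)
        b * (e / 2 * z i x ^+ 2 + (t - 1) ^+ 2 / (2 * e) * y' i ^+ 2))).
      apply: ler_sum => i _.
      rewrite (_ : _ - _ = b * (z i x * ((t - 1) * y' i))); last by ring.
      rewrite ler_wpM2l// -subr_ge0.
      rewrite (_ : _ - _ = (e * z i x - (t - 1) * y' i) ^+ 2 / (2 * e)).
        by rewrite divr_ge0 ?sqr_ge0// mulr_ge0// ltW.
      by field; rewrite gt_eqF.
    rewrite -mulr_sumr big_split/= -!mulr_sumr zn -/Y'.
    rewrite (_ : 5 * b * e * n%:R = b * (e * n%:R / 2 + 9 / 2 * (e * n%:R))); last by field.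
    rewrite ler_wpM2l// mulrAC lerD2l mulrAC ler_pdivrMr ?mulr_gt0//.
    by apply: le_trans tY _; have : 0 <= e ^+ 2 * n%:R; nra.
rewrite !qE !gE -/Y -/Y'.
apply: le_trans (lee_wpmul2r _ (lee_wpmul2l _ mix)) _.
- by rewrite lee_fin mulr_ge0 ?expR_ge0// exprn_ge0// normal_peak_ge0.
- by rewrite lee_fin A0.
rewrite muleA -EFinM muleC muleA -EFinM [leRHS]muleA -EFinM.
apply: lee_wpmul2r.
  by apply: integral_ge0 => x _; exact: (E0 (fun i => b * y' i)).
rewrite lee_fin /A.
set p := normal_peak s ^+ n; set p1 := normal_peak 1 ^+ n.
have p0 : 0 <= p1 * p by rewrite mulr_ge0// exprn_ge0// normal_peak_ge0.
rewrite [leLHS](_ : _ = p1 * p * (expR (- (Y' / 2)) *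
  expR (- ((Y + r ^+ 2 * n%:R) / (2 * s ^+ 2))) * expR (5 * b * e * n%:R))); last by ring.
rewrite [leRHS](_ : _ = p1 * p * (expR (n%:R * e * (6 / s ^+ 2 + 1)) *
  expR (- (Y / 2)) * expR (- ((Y' + r ^+ 2 * n%:R) / (2 * s ^+ 2))))); last by ring.
rewrite ler_wpM2l// -!expRD ler_expR -subr_ge0.
(* The factor 6 / s^2 + 1 pays 1 / s^2 for [A], 5 / s^2 for the Laplace transform since b <= 1 /
   s^2, and 1 for the reference density. *)
rewrite (_ : _ - _ = s ^- 2 * ((Y - Y') / 2 + n%:R * e) +
  5 * (e * n%:R) * (s ^- 2 - b) + (n%:R * e - (Y - Y') / 2)); last first.
  by field; rewrite gt_eqF.
apply: addr_ge0; last by lra.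
apply: addr_ge0; apply: mulr_ge0.
- by rewrite invr_ge0 ltW.
- lra.
- by rewrite mulr_ge0// mulr_ge0// ltW.
- by rewrite subr_ge0.
Qed.

Lemma measurable_integral_section (R : realType) d1 d2 (T1 : measurableType d1)
    (T2 : measurableType d2) (m2 : {sigma_finite_measure set T2 -> \bar R})
    (D : set T2) (f : T1 * T2 -> \bar R) :
  measurable D -> measurable_fun setT f -> (forall p, 0 <= f p)%E ->
  measurable_fun setT (fun x => \int[m2]_(y in D) f (x, y))%E.
Proof.
move=> mD mf f0; pose g := f \_ (setT `*` D).
have mg : measurable_fun setT g.
  apply/(measurable_restrictT _ _).1; last exact: measurable_funTS.
  exact: measurableX.
have g0 p : (0 <= g p)%E by rewrite /g patchE; case: ifP.
apply: (eq_measurable_fun (fubini_F m2 g)); last first.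
  exact: measurable_fun_fubini_tonelli_F.
move=> x _; rewrite /fubini_F [RHS]integral_mkcond; apply: eq_integral => y _.
by rewrite /g !patchE !in_setX in_setT.
Qed.

Lemma fubini_tonelli_set (R : realType) d1 d2 (T1 : measurableType d1)
    (T2 : measurableType d2) (m1 : {sigma_finite_measure set T1 -> \bar R})
    (m2 : {sigma_finite_measure set T2 -> \bar R}) (D : set T2)
    (f : T1 * T2 -> \bar R) :
  measurable D -> measurable_fun setT f -> (forall p, 0 <= f p)%E ->
  (\int[m1]_x \int[m2]_(y in D) f (x, y) =
   \int[m2]_(y in D) \int[m1]_x f (x, y))%E.
Proof.
move=> mD mf f0; pose g := f \_ (setT `*` D).
have mg : measurable_fun setT g.
  apply/(measurable_restrictT _ _).1; last exact: measurable_funTS.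
  exact: measurableX.
have g0 p : (0 <= g p)%E by rewrite /g patchE; case: ifP.
have gE x y : g (x, y) = ((fun y => f (x, y)) \_ D) y.
  by rewrite /g !patchE !in_setX in_setT.
under eq_integral => x _ do
  (rewrite integral_mkcond; under eq_integral do rewrite -gE).
rewrite (@fubini_tonelli _ _ _ _ _ m1 m2 g mg g0) [RHS]integral_mkcond; apply: eq_integral => y _.
rewrite patchE; case: ifPn => yD.
  by apply: eq_integral => x _; rewrite gE patchE yD.
by rewrite integral0_eq// => x _; rewrite gE patchE (negbTE yD).
Qed.

(** The ratio bound is integrated over y' in the shell, where the Gaussian mass is at least 1/2 and
    the mass of the mixture at most 1; this gives the factor 2. *)
Lemma radial_mix_le (R : realType) n d (Om : measurableType d)
    (mu : probability Om R) (z : 'I_n -> Om -> R) (r s e : R)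
    dT (T : measurableType dT) (G : {sigma_finite_measure set T -> \bar R})
    (y : 'I_n -> T -> R) (t : T) :
  (0 < n)%N -> radial mu z -> (forall i, measurable_fun setT (z i)) ->
  (forall x, \sum_(i < n) z i x ^+ 2 = n%:R) ->
  0 <= r <= 1 -> 0 < s -> r ^+ 2 + s ^+ 2 = 1 -> 0 < e <= 2^-1 ->
  2 * expR (- (n%:R * (e ^+ 2 / 40))) <= 2^-1 :> R ->
  lebesgue_coords G y ->
  `|\sum_(i < n) y i t ^+ 2 - n%:R| < n%:R * e ->
  (\int[mu]_x (gauss_dens (fun i => r * z i x) s (y^~ t))%:E <=
   (2 * expR (n%:R * e * (6 / s ^+ 2 + 1)) * gauss_dens (fun=> 0) 1 (y^~ t))%:E)%E.
Proof.
move=> n0 rz mz zn r01 s0 rs e01 small Gy yt; have [my _] := Gy.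
have e0 : 0 < e <= 1 by case/andP: e01 => -> /= ?; lra.
pose S := [set t | n%:R * e <= `|\sum_(i < n) y i t ^+ 2 - n%:R|].
have mS : measurable S.
  apply: measurable_superlevel; apply: measurableT_comp => //.
  by apply: measurable_funB => //; apply: measurable_sum => i; exact: measurable_funX.
have mSC : measurable (~` S) by exact: measurableC.
have mref A : measurable_fun A (fun t => (gauss_dens (fun=> (0 : R)) 1 (y^~ t))%:E).
  apply: measurable_funTS; apply/measurable_EFinP.
  by apply: (@measurable_gauss_dens _ _ _ _ (fun _ _ => 0)); rewrite ?oner_neq0.
have ref0 t' : (0 <= (gauss_dens (fun=> (0 : R)) 1 (y^~ t'))%:E)%E.
  by rewrite lee_fin gauss_dens_ge0.
pose f (p : Om * T) := (gauss_dens (fun i => r * z i p.1) s (y^~ p.2))%:E.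
have mf : measurable_fun setT f.
  apply/measurable_EFinP.
  apply: (@measurable_gauss_dens _ _ _ _ (fun i p => r * z i p.1) (fun i p => y i p.2)).
  - by rewrite gt_eqF.
  - by move=> i; apply: measurable_funM => //; apply: measurableT_comp.
  - by move=> i; apply: measurableT_comp.
have f0 p : (0 <= f p)%E by rewrite lee_fin gauss_dens_ge0.
pose q t' := (\int[mu]_x f (x, t'))%E.
have q0 t' : (0 <= q t')%E by apply: integral_ge0 => x _; exact: f0.
have mq : measurable_fun setT q by exact: (measurable_fun_fubini_tonelli_G f).
have q1 : (\int[G]_t' q t' = 1)%E.
  rewrite -(@fubini_tonelli _ _ _ _ _ mu G f mf f0).
  rewrite (eq_integral (cst 1%E)); last first.
    by move=> x _; rewrite -(integral_gauss_dens (fun i => r * z i x) s Gy).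
  by rewrite integral_cst// mul1e; exact: probability_setT.
have refS : (2^-1%:E <= \int[G]_(t' in ~` S) (gauss_dens (fun=> 0) 1 (y^~ t'))%:E)%E.
  have h1 := @ge0_integral_setU_le _ _ _ G (~` S) S _ mSC mS (mref _) ref0.
  rewrite setUC setUv integral_gauss_dens// in h1.
  (* The standard Gaussian is the case r = 0, s = 1 of the shell bound; the constant vector 1 serves
     as the required z of squared norm n. *)
  have n1 : \sum_(i < n) (1 : R) ^+ 2 = n%:R.
    by under eq_bigr do rewrite expr1n; rewrite sumr_const card_ord.
  have rs0 : (0 : R) ^+ 2 + 1 ^+ 2 = 1 by rewrite expr0n add0r expr1n.
  have h2 := gauss_dens_shell Gy ltr01 rs0 n1 e0.
  have zE : (fun i : 'I_n => 0 * 1) = (fun=> 0 : R) by apply/funext => i; rewrite mul0r.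
  rewrite zE in h2.
  have h3 := le_trans h1 (leeD2l _ (le_trans h2 (_ : _ <= (2^-1)%:E)%E)).
  have : (1%:E - 2^-1%:E <= \int[G]_(t' in ~` S) (gauss_dens (fun=> 0) 1 (y^~ t'))%:E)%E.
    by rewrite leeBlDr//; apply: h3; rewrite lee_fin.
  by rewrite -EFinB (_ : 1 - 2^-1 = 2^-1 :> R)//; field.
set K := expR _.
have step : (q t * 2^-1%:E <= (K * gauss_dens (fun=> 0) 1 (y^~ t))%:E)%E.
  apply: (le_trans (lee_wpmul2l (q0 t) refS)).
  rewrite -ge0_integralZl//.
  apply: (@le_trans _ _ (\int[G]_(t' in ~` S)
      ((K * gauss_dens (fun=> 0) 1 (y^~ t))%:E * q t'))%E).
    apply: ge0_le_integral => //.
    - by move=> t' _; rewrite mule_ge0.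
    - by apply: measurable_funeM; exact: mref.
    - by apply: measurable_funeM; exact: measurable_funTS.
    - move=> t' /= /negP; rewrite -ltNge => t'S.
      exact: (@radial_mix_ratio _ _ _ _ mu z r s e (y^~ t) (y^~ t')
        n0 rz mz zn r01 s0 e01 (ltW yt) (ltW t'S)).
  have K0 : (0 <= (K * gauss_dens (fun=> 0) 1 (y^~ t))%:E)%E.
    by rewrite lee_fin mulr_ge0 ?expR_ge0 ?gauss_dens_ge0.
  rewrite ge0_integralZl//; last exact: measurable_funTS.
  rewrite -[leRHS]mule1 lee_wpmul2l// -q1.
  by apply: ge0_subset_integral.
rewrite (_ : 2 * K * _ = K * gauss_dens (fun=> 0) 1 (y^~ t) * 2); last by ring.
rewrite EFinM; apply: le_trans (lee_wpmul2r _ step) => //.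
by rewrite -muleA -EFinM mulVf ?mule1.
Qed.

(** If the mean over z deviates by [e], then given z the event that y lies in the shell and its mean
    deviates by e/2 has probability at least 1/2. By the density comparison that event has total
    probability at most 4 exp(- n I / 2). [I] and [N] precede [mu] and [z], so the bound is uniform
    over the vectors of a union bound. *)
Lemma sphere_tail (R : realType) (h : R -> R) (C m e : R) :
  measurable_fun setT h -> 0 < C -> (forall x, `|h x| <= C * (1 + x ^+ 2)) ->
  (forall u v, `|h u - h v| <= C * (1 + `|u| + `|v|) * `|u - v|) ->
  (\int[lebesgue_measure]_x (h x * normal_pdf 0 1 x)%:E = m%:E)%E -> 0 < e ->
  exists (I : R) (N : nat), 0 < I /\
  forall n d (Om : measurableType d) (mu : probability Om R) (z : 'I_n -> Om -> R),
    (N <= n)%N -> radial mu z -> (forall i, measurable_fun setT (z i)) ->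
    (forall x, \sum_(i < n) z i x ^+ 2 = n%:R) ->
    (mu [set w | (n%:R * e <= `|\sum_(i < n) h (z i w) - n%:R * m|)%R] <=
     (8 * expR (- (n%:R * I)))%:E)%E.
Proof.
move=> mh C0 hC hL hm e0.
have e20 : 0 < e / 2 by rewrite divr_gt0.
have [I I0 tail] := gauss_mean_tail mh C0 hC hm e20.
(* Smoothing then moves the mean by at most 11 C s <= e/2, and 1 - s^2 stays positive. *)
pose s := Order.min 2^-1 (e / (22 * C)).
have s0 : 0 < s by rewrite lt_min invr_gt0 ltr0n/= divr_gt0// mulr_gt0.
have s2 : s <= 2^-1 by rewrite ge_min lexx.
have sC : 11 * C * s <= e / 2.
  have : s <= e / (22 * C) by rewrite ge_min lexx orbT.
  by rewrite ler_pdivlMr ?mulr_gt0//; lra.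
pose r := Num.sqrt (1 - s ^+ 2).
have rs : r ^+ 2 + s ^+ 2 = 1 by rewrite sqr_sqrtr ?subrK//; nra.
have r0 : 0 <= r by exact: sqrtr_ge0.
have r1 : r <= 1 by nra.
pose c := 6 / s ^+ 2 + 1.
have c0 : 0 < c by rewrite ltr_wpDl// divr_ge0// exprn_ge0// ltW.
(* The density loss exp(n e1 c) consumes at most half of the Cramer rate. *)
pose e1 := Order.min 2^-1 (I / (2 * c)).
have e10 : 0 < e1 by rewrite lt_min invr_gt0 ltr0n/= divr_gt0// mulr_gt0.
have e12 : 0 < e1 <= 2^-1 by rewrite e10 ge_min lexx.
have e11 : 0 < e1 <= 1 by case/andP: e12 => -> /= ?; lra.
have e1c : e1 * c <= I / 2.
  have : e1 <= I / (2 * c) by rewrite ge_min lexx orbT.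
  by rewrite ler_pdivlMr ?mulr_gt0//; lra.
pose k := e1 ^+ 2 / 40.
have k0 : 0 < k by rewrite divr_gt0// exprn_gt0.
have k2 : k <= 2^-1 by rewrite /k; case/andP: e12 => ? ?; nra.
(* Then n k >= 5, hence exp(n k) >= 6 and 3 exp(- n k) <= 1/2: two of these terms bound the
   complement of the shell and one bounds the event that y is far from r z. *)
exists (I / 2), (Num.truncn (5 / k)).+1; split; first by rewrite divr_gt0.
move=> n d Om mu z Nn rz mz zn.
have nk : 5 <= n%:R * k.
  rewrite -ler_pdivrMr//; apply/ltW/(lt_le_trans (truncnS_gt _)).
  by rewrite ler_nat.
have n_gt0 : (0 < n)%N by exact: leq_trans Nn.
have n0 : (0 : R) <= n%:R by [].
have small : 3 * expR (- (n%:R * k)) <= 2^-1.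
  have : expR (n%:R * k) >= 6 by apply: le_trans (expR_ge1Dx _); lra.
  by rewrite expRN; move=> h6; rewrite ler_pdivrMr ?expR_gt0//; lra.
have small2 : 2 * expR (- (n%:R * k)) <= 2^-1.
  by have := expR_ge0 (- (n%:R * k)); lra.
have [dT [T [G [y Gy]]]] := lebesgue_coords_exists R n; have [my _] := Gy.
have mS (g : R -> R) : measurable_fun setT g ->
    measurable_fun setT (fun t => \sum_(i < n) g (y i t)).
  by move=> mg; apply: measurable_sum => i; exact: measurableT_comp.
pose S := [set t | n%:R * e1 <= `|\sum_(i < n) y i t ^+ 2 - n%:R|].
have m_S : measurable S.
  apply: measurable_superlevel; apply: measurableT_comp => //.
  by apply: measurable_funB => //; apply: measurable_sum => i; exact: measurable_funX.
pose B' := [set t | n%:R * (e / 2) <= `|\sum_(i < n) h (y i t) - n%:R * m|].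
have mB' : measurable B'.
  apply: measurable_superlevel; apply: measurableT_comp => //.
  by apply: measurable_funB => //; exact: mS.
pose B := [set w | n%:R * e <= `|\sum_(i < n) h (z i w) - n%:R * m|].
have mB : measurable B.
  apply: measurable_superlevel; apply: measurableT_comp => //.
  apply: measurable_funB => //; apply: measurable_sum => i.
  exact: measurableT_comp.
pose f (p : Om * T) := (gauss_dens (fun i => r * z i p.1) s (y^~ p.2))%:E.
have mf : measurable_fun setT f.
  apply/measurable_EFinP.
  apply: (@measurable_gauss_dens _ _ _ _ (fun i p => r * z i p.1) (fun i p => y i p.2)).
  - by rewrite gt_eqF.
  - by move=> i; apply: measurable_funM => //; apply: measurableT_comp.
  - by move=> i; apply: measurableT_comp.
have f0 p : (0 <= f p)%E by rewrite lee_fin gauss_dens_ge0.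
pose D := B' `&` ~` S.
have mD : measurable D by apply: measurableI => //; exact: measurableC.
have mfx w A : measurable_fun A (fun t => f (w, t)).
  by apply: measurable_funTS; exact: (measurableT_comp mf (pair1_measurable w)).
have half w : B w -> (2^-1%:E <= \int[G]_(t in D) f (w, t))%E.
  move=> Bw.
  pose F := [set t | n%:R * (4 * s ^+ 2) <= \sum_(i < n) (y i t - r * z i w) ^+ 2].
  have mF : measurable F.
    apply: measurable_superlevel; apply: measurable_sum => i.
    by apply: measurable_funX; exact: measurable_funB.
  (* Outside [S] and [F] the perturbation bound applies, and a deviation [e] for z forces a
     deviation e/2 for y. *)
  have DSF : D `|` (S `|` F) = setT.
    apply/seteqP; split=> // t _.
    have [St|nSt] := pselect (S t); first by right; left.
    have [Ft|nFt] := pselect (F t); first by right; right.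
    left; split=> //; rewrite /B'/=.
    move/negP: nSt; rewrite -ltNge => nSt; move/negP: nFt; rewrite -ltNge => nFt.
    have yn : \sum_(i < n) y i t ^+ 2 <= n%:R * 2.
      move: nSt; rewrite ltr_norml => /andP[_ ?].
      by case/andP: e11 => ? ?; nra.
    have := @mean_perturbation R n h C r s (y^~ t) (z^~ w) C0 hL r0 s0 rs (zn w)
      yn (ltW nFt).
    move: Bw; rewrite /B/= => Bw pert.
    have := ler_distD (\sum_(i < n) h (y i t)) (\sum_(i < n) h (z i w)) (n%:R * m).
    rewrite (distrC (\sum_(i < n) h (z i w)) (\sum_(i < n) h (y i t))) => tri.
    have : n%:R * (11 * C * s) <= n%:R * (e / 2) by rewrite ler_wpM2l.
    by lra.
  have h1 := @ge0_integral_setU_le _ _ _ G D (S `|` F) (fun t => f (w, t)) mD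
    (measurableU _ _ m_S mF) (mfx w _) (fun t => f0 (w, t)).
  have f1 : (\int[G]_t f (w, t) = 1)%E.
    exact: (integral_gauss_dens (fun i => r * z i w) s Gy).
  rewrite DSF f1 in h1.
  have h2 : (\int[G]_(t in S `|` F) f (w, t) <= 2^-1%:E)%E.
    apply: le_trans (@ge0_integral_setU_le _ _ _ G S F _ m_S mF (mfx w _)
      (fun t => f0 (w, t))) _.
    apply: le_trans (leeD (gauss_dens_shell Gy s0 rs (zn w) e11)
      (gauss_dens_far (fun i => r * z i w) Gy s0)) _.
    rewrite -EFinD lee_fin; apply: le_trans small.
    rewrite -/k (_ : 3 * expR _ = 2 * expR (- (n%:R * k)) + expR (- (n%:R * k)));
      last by ring.
    by rewrite lerD2l ler_expR lerN2 ler_wpM2l.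
  have : (1%:E - 2^-1%:E <= \int[G]_(t in D) f (w, t))%E.
    by rewrite leeBlDr//; apply: (le_trans h1); rewrite leeD2l.
  by rewrite -EFinB (_ : 1 - 2^-1 = 2^-1 :> R)//; field.
(* After exchanging the integrals, the density comparison and the Cramer bound give 2 exp(n I / 2)
   times 2 exp(- n I). *)
have mix : (\int[mu]_w \int[G]_(t in D) f (w, t) <=
    (4 * expR (- (n%:R * (I / 2))))%:E)%E.
  rewrite (@fubini_tonelli_set _ _ _ _ _ mu G D f mD mf f0).
  set K : R := 2 * expR (n%:R * (I / 2)).
  have K0 : 0 <= K by rewrite mulr_ge0 ?expR_ge0.
  have mref A : measurable_fun A (fun t => (gauss_dens (fun=> (0 : R)) 1 (y^~ t))%:E).
    apply: measurable_funTS; apply/measurable_EFinP.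
    by apply: (@measurable_gauss_dens _ _ _ _ (fun _ _ => 0)); rewrite ?oner_neq0.
  have ref0 t : (0 <= (gauss_dens (fun=> (0 : R)) 1 (y^~ t))%:E)%E.
    by rewrite lee_fin gauss_dens_ge0.
  apply: (@le_trans _ _ (\int[G]_(t in D)
      (K%:E * (gauss_dens (fun=> 0) 1 (y^~ t))%:E))%E).
    apply: ge0_le_integral => //.
    - by move=> t _; apply: integral_ge0 => w _; exact: f0.
    - apply: measurable_funTS; exact: (measurable_fun_fubini_tonelli_G f).
    - by apply: measurable_funeM; exact: mref.
    - move=> t [_ /negP]; rewrite -ltNge => tS.
      apply: le_trans (radial_mix_le n_gt0 rz mz zn _ s0 rs e12 small2 Gy tS) _.
        by rewrite r0.
      rewrite -EFinM lee_fin ler_wpM2r ?gauss_dens_ge0// ler_pM2l// ler_expR.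
      by rewrite -mulrA ler_wpM2l.
  rewrite ge0_integralZl//.
  apply: (@le_trans _ _ (K%:E * (2 * expR (- (n%:R * I)))%:E)%E).
    rewrite lee_wpmul2l//; apply: le_trans (tail _ _ _ _ _ Gy).
    by apply: ge0_subset_integral => //; exact: subIsetl.
  rewrite -EFinM lee_fin /K.
  rewrite [leLHS](_ : _ = 4 * (expR (n%:R * (I / 2)) * expR (- (n%:R * I)))); last by ring.
  rewrite -expRD ler_pM2l// ler_expR; lra.
have : (mu B * 2^-1%:E <= (4 * expR (- (n%:R * (I / 2))))%:E)%E.
  apply: le_trans mix.
  rewrite muleC -integral_cst//.
  apply: (@le_trans _ _ (\int[mu]_(w in B) \int[G]_(t in D) f (w, t))%E).
    apply: ge0_le_integral => //.
    - by move=> w _; rewrite lee_fin invr_ge0.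
    - apply: measurable_funTS.
      exact: (@measurable_integral_section _ _ _ _ _ G D f mD mf f0).
  apply: ge0_subset_integral => //.
  - exact: (@measurable_integral_section _ _ _ _ _ G D f mD mf f0).
  - by move=> w _; apply: integral_ge0 => t _; exact: f0.
move=> muB.
rewrite (_ : 8 * expR _ = 4 * expR (- (n%:R * (I / 2))) * 2); last by ring.
rewrite EFinM; apply: le_trans (lee_wpmul2r _ muB) => //.
by rewrite -muleA -EFinM mulVf ?mule1.
Qed.

(** * Gaussian expectations as Lebesgue integrals *)

Lemma ge0_integral_normal_prob (R : realType) (m s : R) (f : R -> \bar R) :
  measurable_fun setT f -> (forall x, 0 <= f x)%E ->
  (\int[normal_prob m s]_x f x =
   \int[lebesgue_measure]_x (f x * (normal_pdf m s x)%:E))%E.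
Proof.
move=> mf f0; have dom := normal_prob_dominates m s.
rewrite -(Radon_Nikodym_SigmaFinite.change_of_variables dom)//.
have mp : measurable_fun setT (fun x => (normal_pdf m s x)%:E).
  by apply/measurable_EFinP; exact: measurable_normal_pdf.
have ig := Radon_Nikodym_SigmaFinite.f_integrable dom.
have mg := measurable_int _ ig.
apply: ge0_ae_eq_integral => //.
- exact: emeasurable_funM.
- exact: emeasurable_funM.
- by move=> x _; rewrite mule_ge0//; exact: Radon_Nikodym_SigmaFinite.f_ge0.
- by move=> x _; rewrite mule_ge0// lee_fin normal_pdf_ge0.
(* The Radon-Nikodym derivative agrees with the explicit density almost everywhere, both having the
   same integral over every measurable set. *)
have : ae_eq lebesgue_measure setT (Radon_Nikodym_SigmaFinite.f (normal_prob m s)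
    lebesgue_measure) (fun x => (normal_pdf m s x)%:E).
  apply: integral_ae_eq => // A _ mA.
  by rewrite -Radon_Nikodym_SigmaFinite.f_integral.
by apply: filterS => x /= /[apply] ->.
Qed.

(** Positive and negative parts are transported separately; the density, being nonnegative, commutes
    with taking them. *)
Lemma standard_gaussian_expectation (R : realType) d (Om : measurableType d)
    (P : probability Om R) (g : {RV P >-> R}) (h : R -> R) :
  standard_gaussian g -> measurable_fun setT h ->
  (\int[P]_w (h (g w))%:E =
   \int[lebesgue_measure]_x (h x * normal_pdf 0 1 x)%:E)%E.
Proof.
move=> gg mh.
have ge0E (k : R -> \bar R) : measurable_fun setT k -> (forall x, 0 <= k x)%E ->
    (\int[P]_w k (g w) =
     \int[lebesgue_measure]_x (k x * (normal_pdf 0 1 x)%:E))%E.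
  move=> mk k0; rewrite -ge0_integral_normal_prob//.
  pose phi : Om -> measurableTypeR R := g.
  have mphi : measurable_fun setT phi by move=> _ B mB; exact: (measurable_funPT g).
  transitivity (\int[pushforward P phi]_x k x)%E.
    by rewrite ge0_integral_pushforward.
  by apply: eq_measure_integral => A mA _; exact: gg.
have mE : measurable_fun setT (EFin \o h) by exact/measurable_EFinP.
rewrite integralE [RHS]integralE.
congr (_ - _)%E.
  transitivity (\int[P]_w ((EFin \o h)^\+)%E (g w))%E.
    by apply: eq_integral => w _; rewrite !funeposE.
  rewrite ge0E//; last exact: measurable_funepos.
  apply: eq_integral => x _; rewrite !funeposE -EFin_max -EFinM -EFin_max.
  by rewrite maxr_pMl ?normal_pdf_ge0// mul0r.
transitivity (\int[P]_w ((EFin \o h)^\-)%E (g w))%E.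
  by apply: eq_integral => w _; rewrite !funenegE.
rewrite ge0E//; last exact: measurable_funeneg.
apply: eq_integral => x _; rewrite !funenegE -!EFinN -EFin_max -EFinM -EFin_max.
by rewrite maxr_pMl ?normal_pdf_ge0// mul0r mulNr.
Qed.

(** * The Haar measure on the Stiefel manifold *)

Lemma continuous_mulmx (R : realType) n k (Q : 'M[R]_n) :
  continuous (fun A : 'M[R]_(n, k) => Q *m A).
Proof.
move=> M s [P M_P sP].
have : \forall N \near M, forall i j, P i j ((Q *m N) i j).
  have FM : Filter (nbhs M) by exact: nbhs_filter.
  apply: (@filter_forall _ _ (fun i N => forall j, P i j ((Q *m N) i j)) _ FM) => i.
  apply: (@filter_forall _ _ (fun j N => P i j ((Q *m N) i j)) _ FM) => j.
  suff c : (Q *m N) i j @[N --> M] --> (Q *m M) i j by exact: c (M_P i j).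
  rewrite !mxE; under eq_fun do rewrite mxE.
  apply: cvg_big => [|l _]; first exact: add_continuous.
  apply: cvgM; first exact: cvg_cst.
  exact: coord_continuous.
by apply: filterS => N PN; exact: sP.
Qed.

Lemma measurable_stiefel_coord (R : realType) n k (lekn : (k <= n)%N) i j :
  measurable_fun setT (fun A : stiefel_borel R lekn => stiefel_mx A i j).
Proof.
apply: (measurability _ (RGenOpens.measurableE R)) => //.
move=> _ [_ [a [b ->]] <-]; rewrite setTI.
apply: sub_sigma_algebra.
exists ((fun M : 'M[R]_(n, k) => M i j) @^-1` `]a, b[) => //.
by apply: open_comp => // M _; exact: coord_continuous.
Qed.

Lemma measurable_stiefel_act (R : realType) n k (lekn : (k <= n)%N)
    (Q : stiefel R (leqnn n)) :
  measurable_fun setT (stiefel_act Q : stiefel_borel R lekn -> stiefel_borel R lekn).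
Proof.
apply: (@measurability _ _ (stiefel_borel R lekn) (stiefel_borel R lekn) setT _
  (@stiefel_open R n k lekn) erefl).
move=> _ [_ [U oU <-] <-]; rewrite setTI.
apply: sub_sigma_algebra; exists ((fun A : 'M[R]_(n, k) => stiefel_mx Q *m A) @^-1` U) => //.
by apply: open_comp => // M _; exact: continuous_mulmx.
Qed.

Lemma stiefel_haar_integral (R : realType) n k (lekn : (k <= n)%N)
    (mu : probability (stiefel_borel R lekn) R) (Q : stiefel R (leqnn n))
    (f : stiefel_borel R lekn -> \bar R) :
  stiefel_haar mu -> measurable_fun setT f -> (forall A, 0 <= f A)%E ->
  (\int[mu]_A f (stiefel_act Q A) = \int[mu]_A f A)%E.
Proof.
move=> inv mf f0.
transitivity (\int[pushforward mu (stiefel_act Q :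
    stiefel_borel R lekn -> stiefel_borel R lekn)]_A f A)%E.
  by rewrite ge0_integral_pushforward//; exact: measurable_stiefel_act.
apply: eq_measure_integral => [|mact B mB _].
  exact: measurable_stiefel_act.
exact: inv.
Qed.

(** For v <> w, the reflection 1 - 2 x x^T / |x|^2 with x = v - w is symmetric and orthogonal, and
    sends v to w because equal norms give <x, v> = |x|^2 / 2. *)
Lemma householder (R : realType) n (v w : 'cV[R]_n) :
  (v^T *m v) 0 0 = (w^T *m w) 0 0 ->
  exists Q : stiefel R (leqnn n), (stiefel_mx Q)^T *m v = w.
Proof.
move=> vw; pose x := v - w; pose s := (x^T *m x) 0 0.
have [x0|x0] := eqVneq x 0.
  have Q1 : (1%:M : 'M[R]_n)^T *m (1%:M : 'M[R]_n) == 1%:M by rewrite trmx1 mulmx1.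
  exists (Stiefel (leqnn n) Q1) => /=.
  by rewrite trmx1 mul1mx; apply/eqP; rewrite -subr_eq0 -/x x0.
have s0 : s != 0.
  apply: contra_neq x0 => s0; apply/colP => i; rewrite [RHS]mxE.
  have : \sum_i x i 0 ^+ 2 = 0.
    transitivity s => //; rewrite /s [RHS]mxE.
    by apply: eq_bigr => l _; rewrite [_^T _ _]mxE expr2.
  move/eqP; rewrite psumr_eq0 => [/allP /(_ i)|l _]; last exact: sqr_ge0.
  by move=> /(_ (mem_index_enum i)) /=; rewrite sqrf_eq0 => /eqP.
have xx : x^T *m x = s%:M by rewrite [LHS]mx11_scalar.
pose y := x *m x^T.
have yy : y *m y = s *: y by rewrite /y mulmxA -(mulmxA x) xx mul_mx_scalar -scalemxAl.
have yT : y^T = y by rewrite trmx_mul trmxK.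
pose q : 'M[R]_n := 1%:M - (2 / s) *: y.
have qT : q^T = q by rewrite /q linearB linearZ/= trmx1 yT.
have qq : q^T *m q == 1%:M.
  rewrite qT /q mulmxBl mul1mx mulmxBr mulmx1 -scalemxAl -scalemxAr yy !scalerA.
  rewrite (_ : 2 / s * (2 / s) * s = 2 / s + 2 / s); last by field.
  by rewrite scalerDl opprB addrK subrK.
have xv : x^T *m v = (s / 2)%:M.
  rewrite [LHS]mx11_scalar; congr (_%:M).
  have wv : (v^T *m w) 0 0 = (w^T *m v) 0 0.
    by rewrite -[in RHS](trmxK v) -trmx_mul [RHS]mxE.
  have sub00 (a b : 'M[R]_1) : (a - b) 0 0 = a 0 0 - b 0 0 by rewrite !mxE.
  have xT : x^T = v^T - w^T by apply/rowP => i; rewrite !mxE.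
  have -> : s = (v^T *m v) 0 0 - (w^T *m v) 0 0 + ((w^T *m w) 0 0 - (v^T *m w) 0 0).
    by rewrite /s xT /x mulmxBl !mulmxBr !sub00; ring.
  by rewrite -vw wv xT mulmxBl sub00; field.
exists (Stiefel (leqnn n) qq) => /=.
rewrite qT /q mulmxBl mul1mx -scalemxAl /y -mulmxA xv mul_mx_scalar scalerA.
rewrite (_ : 2 / s * (s / 2) = 1); last by field.
by rewrite scale1r /x opprB addrC subrK.
Qed.

(** The coordinates of z = sqrt(n) A u^T / D. *)
Definition stiefel_proj (R : realType) n k (D : R) (u : 'rV[R]_k) (i : 'I_n)
    (A : 'M[R]_(n, k)) : R := Num.sqrt n%:R * inner u (row i A) / D.

Lemma inner_row (R : realType) n k (u : 'rV[R]_k) (A : 'M[R]_(n, k)) i :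
  inner u (row i A) = (A *m u^T) i 0.
Proof.
by rewrite mxE; apply: eq_bigr => j _; rewrite !mxE mulrC.
Qed.

Lemma measurable_stiefel_proj (R : realType) n k (lekn : (k <= n)%N) (D : R)
    (u : 'rV[R]_k) i :
  measurable_fun setT
    (fun A : stiefel_borel R lekn => stiefel_proj D u i (stiefel_mx A)).
Proof.
apply: measurable_funM => //; apply: measurable_funM => //.
apply: measurable_sum => j; apply: measurable_funM => //.
rewrite (_ : (fun _ => _) = (fun A : stiefel_borel R lekn => stiefel_mx A i j)).
  exact: measurable_stiefel_coord.
by apply/funext => A; rewrite mxE.
Qed.

(** Since A^T A = 1, A is an isometry and |A u^T| = |u| = D. *)
Lemma sum_sqr_stiefel_proj (R : realType) n k (lekn : (k <= n)%N) (D : R)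
    (u : 'rV[R]_k) (A : stiefel R lekn) :
  0 < D -> norm2 u = D ->
  \sum_(i < n) stiefel_proj D u i (stiefel_mx A) ^+ 2 = n%:R.
Proof.
move=> D0 uD.
have uu : inner u u = D ^+ 2.
  by rewrite -uD sqr_sqrtr// sumr_ge0// => i _; rewrite -expr2 sqr_ge0.
have aa : \sum_(i < n) inner u (row i (stiefel_mx A)) ^+ 2 = D ^+ 2.
  transitivity (((stiefel_mx A *m u^T)^T *m (stiefel_mx A *m u^T)) 0 0).
    rewrite [RHS]mxE; apply: eq_bigr => i _.
    by rewrite inner_row [(_^T) _ _]mxE expr2.
  rewrite trmx_mul trmxK mulmxA -(mulmxA u) (eqP (stiefelP A)) mulmx1 -uu mxE.
  by apply: eq_bigr => i _; rewrite mxE.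
under eq_bigr do rewrite /stiefel_proj !exprMn sqr_sqrtr// exprVn mulrAC.
by rewrite -mulr_sumr aa divfK// gt_eqF// exprn_gt0.
Qed.

Lemma radial_stiefel_proj (R : realType) n k (lekn : (k <= n)%N) (D : R)
    (u : 'rV[R]_k) (mu : probability (stiefel_borel R lekn) R) :
  stiefel_haar mu ->
  radial mu (fun i (A : stiefel_borel R lekn) => stiefel_proj D u i (stiefel_mx A)).
Proof.
move=> inv v w vw.
(* Q^T v = w and z(Q A) = Q z(A), hence <z(Q A), v> = <z(A), w>. *)
have [Q Qv] : exists Q : stiefel R (leqnn n),
    (stiefel_mx Q)^T *m (\col_i v i) = \col_i w i.
  apply: householder; rewrite !mxE.
  under eq_bigr do rewrite !mxE -expr2; under [RHS]eq_bigr do rewrite !mxE -expr2.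
  exact: vw.
have projE (A : 'M[R]_(n, k)) (x : 'I_n -> R) :
    \sum_(i < n) stiefel_proj D u i A * x i =
    Num.sqrt n%:R / D * ((A *m u^T)^T *m \col_i x i) 0 0.
  rewrite [in RHS]mxE mulr_sumr; apply: eq_bigr => i _.
  by rewrite /stiefel_proj inner_row [(_^T) _ _]mxE [(\col__ _) _ _]mxE; ring.
pose f (A : stiefel_borel R lekn) :=
  (expR (\sum_(i < n) stiefel_proj D u i (stiefel_mx A) * v i))%:E.
have mf : measurable_fun setT f.
  apply/measurable_EFinP; apply: measurableT_comp => //.
  apply: measurable_sum => i; apply: measurable_funM => //.
  exact: measurable_stiefel_proj.
have f0 A : (0 <= f A)%E by rewrite lee_fin expR_ge0.
rewrite -(stiefel_haar_integral Q inv mf f0); apply: eq_integral => A _.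
rewrite /f !projE /= -Qv; congr (expR (_ * _))%:E.
by rewrite -mulmxA trmx_mul mulmxA.
Qed.

(** * Almost sure convergence *)

(** Borel-Cantelli, with the geometric series of ratio exp(- a) as majorant. *)
Lemma ae_eventually_not (R : realType) d (T : measurableType d)
    (mu : {measure set T -> \bar R}) (F : nat -> set T) (N : nat) (C a : R) :
  (forall n, measurable (F n)) -> 0 < a -> 0 <= C ->
  (forall n, (N <= n)%N -> (mu (F n) <= (C * expR (- (n%:R * a)))%:E)%E) ->
  \forall x \ae mu, \forall n \near \oo, ~ F n x.
Proof.
move=> mF a0 C0 muF.
(* The bound starts at [N]; emptying the earlier sets makes it hold along the whole series and
   leaves the limsup unchanged. *)
pose F' n := if (n < N)%N then set0 else F n.
have mF' n : measurable (F' n) by rewrite /F'; case: ifP.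
have q1 : `|expR (- a)| < 1 by rewrite ger0_norm ?expR_ge0// expR_lt1 oppr_lt0.
have sum_lty : (\sum_(0 <= n <oo) mu (F' n) < +oo)%E.
  apply: (@le_lt_trans _ _ (\sum_(0 <= n <oo) (geometric C (expR (- a)) n)%:E)%E).
    apply: lee_nneseries => // n _; rewrite /F'; case: ltnP => [nN|Nn].
      by rewrite measure0 lee_fin mulr_ge0// exprn_ge0// expR_ge0.
    by apply: le_trans (muF _ Nn) _; rewrite /geometric/= -expRM_natl mulrN.
  rewrite (_ : (fun _ => _) = EFin \o series (geometric C (expR (- a)))); last first.
    by apply/funext => n /=; rewrite sumEFin.
  by rewrite EFin_lim ?ltry//; exact: is_cvg_geometric_series.
exists (lim_sup_set F'); split.
- apply: bigcap_measurable; first by exists 0%N.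
  by move=> n _; apply: bigcup_measurable => j _; exact: mF'.
- exact: lim_sup_set_cvg0.
move=> x /= nx n _; apply: contrapT => nF; apply: nx.
exists (maxn n N) => // j /=; rewrite geq_max => /andP[nj Nj] Fj.
by apply: nF; exists j => //; rewrite /F' ltnNge Nj.
Qed.

Lemma limn_esup_near_lt (R : realType) (u : nat -> \bar R) (x : \bar R) :
  (limn_esup u < x)%E -> \forall n \near \oo, (u n < x)%E.
Proof.
move=> ux.
have cu : cvgn (esups u) by exact: is_cvg_esups.
rewrite limn_esup_lim in ux.
have [N Nx] : exists N, (esups u N < x)%E.
  apply/not_existsP => h.
  have : (x <= limn (esups u))%E.
    by apply: lime_ge => //; apply: nearW => n; rewrite leNgt; apply/negP/h.
  by rewrite leNgt ux.
exists N => // n /= Nn; apply: le_lt_trans Nx.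
by apply: ereal_sup_ubound; exists n.
Qed.

(** The growth bound of order (0, 0) gives the quadratic growth, and that of order (1, 0) with the
    mean value theorem gives the Lipschitz estimate. Adding 1 to [C c] makes the constant
    positive. *)
Lemma growth_bounded_lipschitz (R : realType) (L : R -> R -> \bar R) (T : \bar R)
    (c : R) (f := fun t => fine (L t c)) :
  regular_below L T -> growth_bounded_below L T -> (c%:E < T)%E ->
  exists K : R, [/\ 0 < K, continuous f, forall t, `|f t| <= K * (1 + t ^+ 2) &
    forall u v, `|f u - f v| <= K * (1 + `|u| + `|v|) * `|u - v|].
Proof.
move=> [_ _ Ld] [C [_ C0 LC]] cT.
have df t : derivable f t 1 by have := Ld 1%N 0%N t c isT cT.
have f_cont : continuous f.
  by move=> t; apply/differentiable_continuous/derivable1_diffP/df.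
have f'C t : `|derive1 f t| <= C c * (1 + `|t|) by have := LC 1%N 0%N t c isT cT; rewrite expr1.
exists (C c + 1); split=> //.
- by rewrite ltr_wpDl// C0.
- move=> t; have := LC 0%N 0%N t c isT cT; rewrite subn0 real_normK ?num_real// => h.
  apply: (le_trans h); rewrite ler_wpM2r ?addr_ge0 ?sqr_ge0//; lra.
have lip u v : u <= v -> `|f v - f u| <= (C c + 1) * (1 + `|u| + `|v|) * `|v - u|.
  move=> uv.
  have [x xuv ->] : exists2 x, x \in `[u, v]%R & f v - f u = derive1 f x * (v - u).
    apply: MVT_segment => //.
      by move=> x _; rewrite derive1E; exact: derivableP.
    exact: continuous_subspaceT.
  rewrite normrM ler_wpM2r//; apply: le_trans (f'C x) _.
  have : `|x| <= `|u| + `|v|.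
    move: xuv; rewrite in_itv/= => /andP[ux xv].
    rewrite ler_norml; apply/andP; split.
      by have := ler_norm (- u); rewrite normrN; have := normr_ge0 v; lra.
    by have := ler_norm v; have := normr_ge0 u; lra.
  by have := C0 c cT; have := normr_ge0 x; nra.
move=> u v; have [uv|/ltW vu] := leP u v.
  by rewrite distrC (distrC u); exact: lip.
by rewrite addrAC; exact: lip.
Qed.

Lemma measure_bigsetU_le (R : realType) d (T : measurableType d)
    (mu : {measure set T -> \bar R}) (I : Type) (r : seq I) (F : I -> set T) :
  (forall i, measurable (F i)) ->
  (mu (\big[setU/set0]_(i <- r) F i) <= \sum_(i <- r) mu (F i))%E.
Proof.
move=> mF; elim: r => [|i r IH]; first by rewrite !big_nil measure0.
rewrite !big_cons; apply: (@le_trans _ _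
  (mu (F i) + mu (\big[setU/set0]_(j <- r) F j))%E); last exact: leeD2l.
by apply: measureU2 => //; exact: bigsetU_measurable.
Qed.

Lemma empirical_log_laplaceE (R : realType) (L : R -> R -> \bar R) (c D : R)
    (h : R -> R) n k (u : 'rV[R]_k) (A : 'M[R]_(n, k)) :
  D != 0 -> (forall t, L (D * t) c = (h t)%:E) ->
  empirical_log_laplace L u A c =
  (n%:R^-1 * \sum_(i < n) h (stiefel_proj D u i A))%:E.
Proof.
move=> D0 LE; rewrite /empirical_log_laplace EFinM -sumEFin.
congr (_ * _)%E; apply: eq_bigr => i _.
rewrite -LE; congr (L _ c); rewrite /stiefel_proj mulrC divfK// /inner mulr_sumr.
by apply: eq_bigr => j _; rewrite !mxE mulrCA.
Qed.

(* Following the 0-based indexing of nat, X 0 stands for X_1. *)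
Theorem lemma3p6 (R : realType)
  (k : nat -> nat) (lekn : forall n : nat, (k n <= n)%N)
  (k_pos : forall n : nat, (0 < n)%N -> (0 < k n)%N)
  (k_incr : forall n : nat, (k n <= k n.+1)%N)
  (k_oo : k @ \oo --> \oo)
  (k_small : (k n)%:R / n%:R @[n --> \oo] --> (0 : R))
  (D : R) (D_pos : 0 < D)
  (d : nat -> nat) (d_pos : forall n : nat, (0 < n)%N -> (0 < d n)%N)
  (d_subexp : limn_esup (fun n : nat => (n%:R^-1 * ln ((d n)%:R : R))%:E)
              = 0%:E)
  (eta : R -> R) (eta_cont : continuous eta) (eta_ge0 : forall x : R, 0 <= eta x)
  (eta_nonconst : exists x y : R, eta x != eta y)
  (dOm : measure_display) (Om : measurableType dOm) (P : probability Om R)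
  (X : nat -> {RV P >-> R}) (X_iid : iid X)
  (X_subgaussian : centered_subgaussian (X 0%N))
  (T : \bar R) (T_pos : (0 < T)%E)
  (L_regular : regular_below (log_laplace eta (X 0%N)) T)
  (L_growth : growth_bounded_below (log_laplace eta (X 0%N)) T)
  (v : forall n : nat, 'I_(d n) -> 'rV[R]_(k n))
  (v_norm : forall (n : nat) (j : 'I_(d n)), (0 < n)%N -> norm2 (v n j) = D)
  (c : R) (c_lt : (c%:E < T)%E)
  (sigma_ : forall n : nat, probability (stiefel_borel R (lekn n)) R)
  (sigma_haar : forall n : nat, stiefel_haar (sigma_ n))
  (sigma : probability (stiefel_prod R lekn) R)
  (sigma_marginal : forall (n : nat) (B : set (stiefel_borel R (lekn n))),
    measurable B -> sigma [set a | B (a n)] = sigma_ n B)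
  (dG : measure_display) (OmG : measurableType dG) (PG : probability OmG R)
  (g : {RV PG >-> R}) (g_gauss : standard_gaussian g) :
  \forall a \ae sigma,
    ereal_sup [set (`| empirical_log_laplace (log_laplace eta (X 0%N))
                         (v n j) (stiefel_mx (a n)) c
                       - \int[PG]_w log_laplace eta (X 0%N) (D * g w)%R c |)%E
              | j in [set: 'I_(d n)]]
    @[n --> \oo] --> 0%:E.
Proof.
have [L_fin _ _] := L_regular.
have [K [K0 f_cont f_quad f_lip]] := growth_bounded_lipschitz L_regular L_growth c_lt.
set L := log_laplace eta (X 0%N) in L_fin f_cont f_quad f_lip *.
pose h t := fine (L (D * t) c).
have LE t : L (D * t) c = (h t)%:E by rewrite /h fineK// L_fin.
have mh : measurable_fun setT h.
  apply: (measurableT_comp (continuous_measurable_fun f_cont)).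
  exact: measurable_funM.
(* (1 + D)^2 absorbs the substitution of D t for t both in the growth bound and in the Lipschitz
   bound, which gains a further factor D. *)
pose C := K * (1 + D) ^+ 2.
have C0 : 0 < C by rewrite mulr_gt0// exprn_gt0// addr_gt0.
have h_quad t : `|h t| <= C * (1 + t ^+ 2).
  apply: le_trans (f_quad _) _; rewrite /C -mulrA ler_pM2l// exprMn.
  by have := sqr_ge0 t; have := sqr_ge0 D; nra.
have h_lip x y : `|h x - h y| <= C * (1 + `|x| + `|y|) * `|x - y|.
  apply: le_trans (f_lip _ _) _; rewrite -mulrBr !normrM (ger0_norm (ltW D_pos)).
  rewrite mulrA ler_wpM2r// /C -!mulrA ler_pM2l// (mulrC _ D).
  have : 0 <= D * `|x| by rewrite mulr_ge0// ltW.
  have : 0 <= D * `|y| by rewrite mulr_ge0// ltW.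
  have := normr_ge0 x; have := normr_ge0 y; nra.
pose m := fine (\int[lebesgue_measure]_x (h x * normal_pdf 0 1 x)%:E)%E.
have hm : (\int[lebesgue_measure]_x (h x * normal_pdf 0 1 x)%:E = m%:E)%E.
  rewrite /m fineK//; apply: integrable_fin_num => //.
  exact: integrable_quadratic_normal h_quad.
have Eg : (\int[PG]_w L (D * g w)%R c = m%:E)%E.
  by under eq_integral do rewrite LE; rewrite standard_gaussian_expectation.
pose dev n (j : 'I_(d n)) (B : stiefel_borel R (lekn n)) :=
  `|\sum_(i < n) h (stiefel_proj D (v n j) i (stiefel_mx B)) - n%:R * m|.
have mdev n j : measurable_fun setT (@dev n j).
  apply: measurableT_comp => //; apply: measurable_funB => //.
  apply: measurable_sum => i; apply: (measurableT_comp mh).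
  exact: measurable_stiefel_proj.
(* The tolerances 1 / (p + 1) are countably many, so the exceptional null sets can be united over
   [p]. *)
pose bad p n : set (stiefel_borel R (lekn n)) :=
  \big[setU/set0]_(j <- index_enum 'I_(d n))
    [set B | n%:R * p.+1%:R^-1 <= dev n j B].
have mbad p n : measurable (bad p n).
  by apply: bigsetU_measurable => j _; exact: measurable_superlevel.
have good p : \forall a \ae sigma, \forall n \near \oo, ~ bad p n (a n).
  have p0 : (0 : R) < p.+1%:R^-1 by rewrite invr_gt0.
  have [I [N [I0 tail]]] := sphere_tail mh C0 h_quad h_lip hm p0.
  (* Subexponential growth gives d_n <= exp(n I / 2) eventually, so the union bound costs half of
     the rate. *)
  have [N1 _ dN] : \forall n \near \oo, ((n%:R^-1 * ln (d n)%:R : R)%:E < (I / 2)%:E)%E.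
    by apply: limn_esup_near_lt; rewrite d_subexp lte_fin divr_gt0.
  apply: (@ae_eventually_not R _ (stiefel_prod R lekn) sigma
    (fun n => [set a : stiefel_prod R lekn | bad p n (a n)])
    (maxn (maxn N N1) 1) 8 (I / 2)) => //.
  - move=> n; apply: sub_sigma_algebra; exists n, (bad p n); split=> //.
  - by rewrite divr_gt0.
  move=> n; rewrite !geq_max => /andP[/andP[Nn N1n] n0].
  apply: (@le_trans _ _ (sigma_ n (bad p n))).
    by rewrite -(sigma_marginal n (bad p n) (mbad p n)).
  apply: le_trans (measure_bigsetU_le _ _ _) _ => [j|].
    exact: measurable_superlevel.
  apply: (@le_trans _ _ (\sum_(j < d n) (8 * expR (- (n%:R * I)))%:E)%E).
    apply: lee_sum => j _; apply: tail => //.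
    - exact: radial_stiefel_proj.
    - by move=> i; exact: measurable_stiefel_proj.
    - by move=> B; apply: sum_sqr_stiefel_proj => //; exact: v_norm.
  rewrite sumEFin lee_fin sumr_const card_ord -[_ *+ d n]mulr_natl.
  rewrite mulrCA ler_pM2l//.
  have n0' : (0 : R) < n%:R by rewrite ltr0n.
  have dle : (d n)%:R <= expR (n%:R * (I / 2)).
    rewrite -[leLHS]lnK ?posrE ?ltr0n ?d_pos// ler_expR mulrC -ler_pdivrMr//.
    by rewrite mulrC ltW// -lte_fin; exact: dN.
  apply: (@le_trans _ _ (expR (n%:R * (I / 2)) * expR (- (n%:R * I)))).
    by rewrite ler_wpM2r ?expR_ge0.
  by rewrite -expRD ler_expR; lra.
apply: filterS (ae_foralln good) => a good_a.
set G := (X in X @ \oo --> _).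
have Gp p : \forall n \near \oo, (0 <= G n <= (p.+1%:R^-1)%:E)%E.
  have [N _ gN] := good_a p.
  exists (maxn N 1) => // n /=; rewrite geq_max => /andP[Nn n0].
  have n0' : (0 : R) < n%:R by rewrite ltr0n.
  (* The supremum of an empty family would be -oo; d_n > 0 for n >= 1 provides an index and hence
     nonnegativity. *)
  rewrite /G; apply/andP; split.
    apply: (@le_trans _ _ (`| empirical_log_laplace L (v n (Ordinal (d_pos n n0)))
      (stiefel_mx (a n)) c - \int[PG]_w L (D * g w)%R c |)%E); first exact: abse_ge0.
    by apply: ereal_sup_ubound; exists (Ordinal (d_pos n n0)).
  apply: ge_ereal_sup => _ [j _ <-].
  rewrite Eg (@empirical_log_laplaceE _ _ _ D h) ?gt_eqF// -EFinB abse_EFin lee_fin.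
  set s := \sum_(i < n) _.
  rewrite (_ : _ - m = n%:R^-1 * (s - n%:R * m)); last by field; rewrite gt_eqF.
  rewrite normrM ger0_norm ?invr_ge0// mulrC ler_pdivrMr//.
  rewrite leNgt; apply/negP => /ltW dev_ge; apply: (gN n Nn).
  by rewrite /bad -bigcup_seq; exists j; [exact: mem_index_enum|rewrite /= [leLHS]mulrC].
apply/fine_cvgP; split.
  apply: filterS (Gp 0%N) => n /andP[G0 G1].
  by rewrite ge0_fin_numE// (le_lt_trans G1)// ltry.
apply/cvgrPdist_le => e e0.
(* With p the integer part of 1 / e, the tolerance 1 / (p + 1) is below [e]. *)
apply: filterS (Gp (Num.truncn e^-1)) => n /andP[G0 G1] /=.
have Gfin : G n \is a fin_num by rewrite ge0_fin_numE// (le_lt_trans G1)// ltry.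
rewrite sub0r normrN ger0_norm ?fine_ge0//.
rewrite -lee_fin fineK//; apply: (le_trans G1); rewrite lee_fin.
by rewrite -[leRHS]invrK lef_pV2 ?posrE ?invr_gt0// ltW// truncnS_gt.
Qed.
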